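(* Assume $H^0(\Delta_\wp,V)=0$. Let $T$ and $T_1$ be two $\Delta$-stable $\mathcal{O}$-lattices in $V$ such that $X^{GV}_{\mathbb{Q}_\infty}(T,T_\wp^+)$ and $X^{GV}_{\mathbb{Q}_\infty}(T_1,(T_1)_\wp^+)$ are finitely generated torsion $\Lambda_{\mathcal{O}}$-modules. Then $X^{GV}_{\mathbb{Q}_\infty}(T,T_\wp^+)$ and $X^{GV}_{\mathbb{Q}_\infty}(T_1,(T_1)_\wp^+)$ have the same characteristic ideal in $\Lambda_{\mathcal{O}}$. In particular their $\mu$-invariants coincide.
   Context: Fix an odd prime $p$ and a finite Galois extension $K/\mathbb{Q}$ with $\mu_p\subset K$ and $p\nmid[K:\mathbb{Q}]$; $\Delta=\mathrm{Gal}(K/\mathbb{Q})$. Fix embeddings $\overline{\mathbb{Q}}\hookrightarrow\mathbb{C}$, $\overline{\mathbb{Q}}\hookrightarrow\overline{\mathbb{Q}}_p$; the latter determines a prime $\wp$ of $K$ above $p$ with decomposition group $\Delta_\wp$. Let $\mathcal{F}/\mathbb{Q}_p$ be finite with ring of integers $\mathcal{O}$ and uniformizer $\pi$. Let $\rho:\Delta\to\mathrm{GL}_{\mathcal{F}}(V)$ be irreducible of dimension $d$, $d^+$ the multiplicity of the trivial representation in the restriction of $\rho$ to the decomposition group of an archimedean place of $K$. Assume $V$ has a $\Delta_\wp$-stable subspace $V_\wp^+$ of dimension $d^+$, $0<d^+<d$, such that $V_\wp^+$ and $V_\wp^-:=V/V_\wp^+$ have no common irreducible $\Delta_\wp$-constituent.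 For a $\Delta$-stable $\mathcal{O}$-lattice $T$ of $V$, let $T_\wp^+=T\cap V_\wp^+$, $A=V/T$, $A_\wp^+$ the image of $V_\wp^+$ in $A$, $A_\wp^-=A/A_\wp^+$. Galois groups act through $\Delta$ (local ones at primes above $p$ through $\Delta_\wp$). Let $\Sigma$ be a finite set of places of $\mathbb{Q}$ containing $p,\infty$ and the primes ramified in $K$; $\mathbb{Q}_\Sigma$ the maximal extension unramified outside $\Sigma$. $\mathbb{Q}_\infty$ is the cyclotomic $\mathbb{Z}_p$-extension of $\mathbb{Q}$, $\Gamma=\mathrm{Gal}(\mathbb{Q}_\infty/\mathbb{Q})$, $\mathbb{Q}_n$ its layer of degree $p^n$, $\mathfrak{p}_n$ the prime of $\mathbb{Q}_n$ above $p$, $I_\omega$ inertia groups, and $\Lambda_{\mathcal{O}}=\mathcal{O}[[\Gamma]]$. $Sel^{GV}_{\mathbb{Q}_n}(A,A_\wp^+)=\ker\big(H^1(\mathbb{Q}_\Sigma/\mathbb{Q}_n,A)\to\bigoplus_\omega H^1(I_\omega,A)\oplus H^1(I_{\mathfrak{p}_n},A_\wp^-)\big)$, $\omega$ over finite primes of $\mathbb{Q}_n$ above primes of $\Sigma$ other than $p$; $Sel^{GV}_{\mathbb{Q}_\infty}(A,A_\wp^+)=\varinjlim_n Sel^{GV}_{\mathbb{Q}_n}(A,A_\wp^+)$ and $X^{GV}_{\mathbb{Q}_\infty}(T,T_\wp^+)=\mathrm{Hom}_{\mathrm{cont}}(Sel^{GV}_{\mathbb{Q}_\infty}(A,A_\wp^+),\mathbb{Q}_p/\mathbb{Z}_p)$,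 a $\Lambda_{\mathcal{O}}$-module. The characteristic ideal of a finitely generated torsion $\Lambda_{\mathcal{O}}$-module is the usual one from the structure theorem; its $\mu$-invariant is the largest $n$ with characteristic ideal contained in $\pi^n\Lambda_{\mathcal{O}}$. *)

(* Defs.v *)
From HB Require Import structures.
From mathcomp Require Import all_boot all_order all_algebra all_fingroup.
From mathcomp Require Import all_solvable all_field all_character.
From mathcomp Require Import boolp classical_sets functions cardinality.

Set Implicit Arguments.
Unset Strict Implicit.
Unset Printing Implicit Defensive.

Import Order.TTheory GRing.Theory Num.Theory.
Local Open Scope ring_scope.
Local Open Scope quotient_scope.
Local Open Scope classical_set_scope.
Local Notation qrep := generic_quotient.repr.

Record submodule (R : nzRingType) (V : lmodType R) := Submodule {
  submod_set :> V -> Prop;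
  submod0 : submod_set 0;
  submod_lin : forall a u v,
    submod_set u -> submod_set v -> submod_set (a *: u + v) }.

Section Submodule.
Variables (R : nzRingType) (V : lmodType R) (S : submodule V).

Lemma submodD u v : S u -> S v -> S (u + v).
Proof. by move=> Su Sv; rewrite -[u]scale1r; apply: submod_lin. Qed.

Lemma submodZ a u : S u -> S (a *: u).
Proof. by move=> Su; rewrite -[_ *: _]addr0; apply/submod_lin/submod0. Qed.

Lemma submodN u : S u -> S (- u).
Proof. by rewrite -scaleN1r; apply: submodZ. Qed.

Lemma submodB u v : S u -> S v -> S (u - v).
Proof. by move=> Su Sv; apply/submodD/submodN. Qed.

Lemma submod_sum I (r : seq I) (P : pred I) (f : I -> V) :
  (forall i, P i -> S (f i)) -> S (\sum_(i <- r | P i) f i).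
Proof. by move=> Sf; elim/big_rec: _ => [|i x Pi Sx]; [apply: submod0 | apply/submodD/Sx/Sf]. Qed.

Definition submod_pred : pred V := fun v => `[< S v >].

Fact submod_pred_closed : zmod_closed submod_pred.
Proof.
split=> [|u v /asboolP Su /asboolP Sv]; apply/asboolP; first exact: submod0.
exact: submodB.
Qed.

HB.instance Definition _ := GRing.isZmodClosed.Build V submod_pred submod_pred_closed.

Definition submod_type := {v : V | submod_pred v}.

Definition quotmod := Quotient.quot (GRing.ZmodClosed.clone V submod_pred _).

End Submodule.

HB.instance Definition _ (R : nzRingType) (V : lmodType R) (S : submodule V) := Choice.on (@submod_type R V S).
HB.instance Definition _ (R : nzRingType) (V : lmodType R) (S : submodule V) := [isSub of @submod_type R V S for sval].
Fact submod_pred_submod R V S : subsemimod_closed (@submod_pred R V S).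
Proof.
split=> [|a u /asboolP Su]; last exact/asboolP/submodZ.
split=> [|u v /asboolP Su /asboolP Sv]; apply/asboolP; first exact: submod0.
exact: submodD.
Qed.
HB.instance Definition _ (R : nzRingType) (V : lmodType R) (S : submodule V) :=
  GRing.SubChoice_isSubLmodule.Build R V (@submod_pred R V S) (@submod_type R V S)
   (submod_pred_submod S).

HB.instance Definition _ (R : nzRingType) (V : lmodType R) (S : submodule V) := GRing.Zmodule.on (@quotmod R V S).
HB.instance Definition _ (R : nzRingType) (V : lmodType R) (S : submodule V) := EqQuotient.on (@quotmod R V S).

Section QuotMod.
Variables (R : nzRingType) (V : lmodType R) (S : submodule V).
Local Notation Q := (quotmod S).
Definition qpi (v : V) : Q := \pi_Q v.
Lemma qpiP u v : (qpi u = qpi v) <-> S (u - v).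
Proof.
split=> [/eqP|Suv]; first by rewrite -[_ == _]Quotient.idealrBE => /asboolP.
by apply/eqP; rewrite -[_ == _]Quotient.idealrBE; apply/asboolP.
Qed.
Lemma qpiK (x : Q) : qpi (qrep x) = x.
Proof. exact: reprK. Qed.
Lemma qpiB : zmod_morphism qpi.
Proof. exact: pi_is_zmod_morphism. Qed.
HB.instance Definition _ := GRing.isZmodMorphism.Build V Q qpi qpiB.

Definition qscale (a : R) (x : Q) : Q := qpi (a *: qrep x).
Lemma qpiZ_ a v : qscale a (qpi v) = qpi (a *: v).
Proof. by apply/qpiP; rewrite -scalerBr; apply/submodZ/qpiP; rewrite qpiK. Qed.
Fact qscaleA a b x : qscale a (qscale b x) = qscale (a * b) x.
Proof. by rewrite -[x]qpiK !qpiZ_ scalerA. Qed.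
Fact qscale1 : left_id 1 qscale.
Proof. by move=> x; rewrite -[x]qpiK !qpiZ_ scale1r. Qed.
Fact qscaleDr : right_distributive qscale +%R.
Proof. by move=> a x y; rewrite -[x]qpiK -[y]qpiK -raddfD !qpiZ_ scalerDr raddfD. Qed.
Fact qscaleDl x : {morph qscale^~ x : a b / a + b}.
Proof. by move=> a b; rewrite -[x]qpiK !qpiZ_ scalerDl raddfD. Qed.
HB.instance Definition _ :=
  GRing.Zmodule_isLmodule.Build R Q qscaleA qscale1 qscaleDr qscaleDl.
Fact qpiZ : scalable qpi.
Proof. by move=> a v; rewrite -qpiZ_. Qed.
HB.instance Definition _ := GRing.isScalable.Build R V Q _ qpi qpiZ.
End QuotMod.

(* Qbar is algC, the algebraic numbers with a chosen complex conjugation;   *)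
(* every ring endomorphism of algC is an automorphism.                      *)
Definition absGalQ := {rmorphism algC -> algC}.
HB.instance Definition _ := gen_eqMixin absGalQ.
HB.instance Definition _ := gen_choiceMixin absGalQ.
Lemma absGalP (s t : absGalQ) : s =1 t -> s = t.
Proof.
move/funext; case: s t => [s [[sB] [sM]]] [t [[tB] [tM]]]; rewrite /= => st.
by subst t; rewrite (Prop_irrelevance sB tB) (Prop_irrelevance sM tM).
Qed.

Definition absgal_id : absGalQ := (idfun : {rmorphism algC -> algC}).
Definition absgal_comp (s t : absGalQ) : absGalQ :=
  ((s : {rmorphism algC -> algC}) \o (t : {rmorphism algC -> algC})
    : {rmorphism algC -> algC}).
Definition absgal_inv (s : absGalQ) : absGalQ :=
  (algC_invaut s : {rmorphism algC -> algC}).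

Lemma gal_compA : associative absgal_comp.
Proof. by move=> s t u; apply: absGalP. Qed.
Lemma gal_comp1s : left_id absgal_id absgal_comp.
Proof. by move=> s; apply: absGalP. Qed.
Lemma gal_comps1 : right_id absgal_id absgal_comp.
Proof. by move=> s; apply: absGalP. Qed.
Lemma gal_compVs : left_inverse absgal_id absgal_inv absgal_comp.
Proof. by move=> s; apply: absGalP => x; exact: algC_autK. Qed.
Lemma gal_compsV : right_inverse absgal_id absgal_inv absgal_comp.
Proof. by move=> s; apply: absGalP => x; exact: algC_invautK. Qed.

HB.instance Definition _ := isGroup.Build absGalQ
  gal_compA gal_comp1s gal_comps1 gal_compVs gal_compsV.

Lemma absgalM (s t : absGalQ) x : (s * t)%g x = s (t x). Proof. by []. Qed.
Lemma absgal1 x : (1 : absGalQ)%g x = x. Proof. by []. Qed.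
Lemma absgalK (s : absGalQ) : cancel s (s^-1)%g.
Proof. by move=> x; rewrite -absgalM mulVg. Qed.
Lemma absgalVK (s : absGalQ) : cancel (s^-1)%g s.
Proof. by move=> x; rewrite -absgalM mulgV. Qed.

Definition agree_on (L : set algC) (s t : absGalQ) := forall x, L x -> s x = t x.

Definition GalOver (L : set algC) : set absGalQ := [set s | agree_on L s 1%g].

(* Q_n, for p odd: the subfield of Q(mu_(p^(n+1))) fixed by the subgroup of *)
(* order p - 1 of its Galois group.                                        *)
Definition cyclo_layer (p n : nat) : set algC :=
  [set x | exists z, [/\ (p ^ n.+1).-primitive_root z,
     exists P : {poly rat}, x = (map_poly ratr P).[z] &
     forall s : absGalQ, (s ^+ p.-1)%g z = z -> s x = x]].

Section Layer.
Variables p n : nat.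
Local Notation L := (cyclo_layer p n).

Lemma gal_horner (s : absGalQ) (P : {poly rat}) z :
  s (map_poly ratr P).[z] = (map_poly ratr P).[s z].
Proof.
rewrite -horner_map -map_poly_comp; congr (_.[_]).
by apply: eq_map_poly => a /=; apply: fmorph_rat.
Qed.

Lemma gal_prim_root N z (s : absGalQ) :
  N.-primitive_root z -> exists k, s z = z ^+ k.
Proof.
move=> pz; have /(prim_rootP pz)[k ->] : s z ^+ N = 1.
  by rewrite -rmorphXn /= prim_expr_order ?rmorph1.
by exists k.
Qed.

Lemma galX (s : absGalQ) z k m : (s ^+ m)%g z = z -> (s ^+ m)%g (z ^+ k) = z ^+ k.
Proof. by move=> sz; rewrite [LHS]rmorphXn /= sz. Qed.

Lemma layer_gal (s : absGalQ) x : L x -> L (s x).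
Proof.
move=> [z [pz [P Dx] fx]]; have [k sz] := gal_prim_root s pz.
exists z; split=> //.
  by exists (P \Po 'X^k); rewrite Dx gal_horner sz map_comp_poly map_polyXn horner_comp hornerXn.
move=> t tz; have /fx : ((s^-1 * t * s) ^+ p.-1)%g z = z.
  rewrite -mulgA -[(s^-1 * _)%g]/((s^-1 * (t * s))%g).
  have -> : forall m, ((s^-1 * (t * s)) ^+ m)%g = (s^-1 * (t ^+ m * s))%g.
    elim=> [|m IHm]; first by rewrite !expg0 mul1g mulVg.
    by rewrite !expgS IHm !mulgA mulgK.
  rewrite !absgalM sz galX // -sz; exact: absgalK.
by rewrite !absgalM => /(congr1 s); rewrite absgalVK.
Qed.

Lemma agree_prim z (s t : absGalQ) :
  (p ^ n.+1).-primitive_root z -> s z = t z -> agree_on L s t.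
Proof.
move=> pz st x [w [pw [P ->] _]]; rewrite !gal_horner; congr (_.[_]).
have /(prim_rootP pz)[k ->] : w ^+ (p ^ n.+1) = 1 by rewrite prim_expr_order.
by rewrite !rmorphXn /= st.
Qed.

Lemma agree_comm (s t : absGalQ) : agree_on L (s * t)%g (t * s)%g.
Proof.
move=> x [z [pz [P Dx] fx]]; apply: (agree_prim pz); last by exists z; split=> //; exists P.
have [[k sz] [m tz]] := (gal_prim_root s pz, gal_prim_root t pz).
by rewrite !absgalM sz tz !rmorphXn /= sz tz -!exprM mulnC.
Qed.

Lemma layerS x : L x -> cyclo_layer p n.+1 x.
Proof.
move=> [z [pz [P Dx] fx]].
have p_gt0 : (0 < p ^ n.+2)%N.
  by move: (prim_order_gt0 pz); rewrite !expn_gt0; case: (p).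
have [w pw] := C_prim_root_exists p_gt0.
have /(prim_rootP pw)[k Dz] : z ^+ (p ^ n.+2) = 1.
  by rewrite expnS mulnC exprM (prim_expr_order pz) expr1n.
exists w; split=> //.
  by exists (P \Po 'X^k); rewrite Dx Dz map_comp_poly map_polyXn horner_comp hornerXn.
by move=> s sw; apply: fx; rewrite Dz galX.
Qed.

Definition agree_rel : rel absGalQ := fun s t => `[< agree_on L s t >].
Fact agree_equiv : equiv_class_of agree_rel.
Proof.
split=> [s|s t|t s u].
- exact/asboolP.
- by apply/asboolP/asboolP => st x Lx; rewrite st.
- by move=> /asboolP st /asboolP tu; apply/asboolP => x Lx; rewrite st ?tu.
Qed.
Canonical agree_equiv_rel := EquivRelPack agree_equiv.
Canonical agree_enc := defaultEncModRel agree_rel.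

(* Gal(Q_n/Q), as the quotient of Gal(Qbar/Q) by Gal(Qbar/Q_n). *)
Definition gal_layer := {eq_quot agree_rel}.
HB.instance Definition _ := EqQuotient.on gal_layer.
HB.instance Definition _ := Choice.on gal_layer.

Definition res_layer (s : absGalQ) : gal_layer := \pi_gal_layer s.
Definition lift_layer (g : gal_layer) : absGalQ := qrep g.

Lemma res_layerP s t : res_layer s = res_layer t <-> agree_on L s t.
Proof.
split=> [/eqmodP/asboolP //|st].
exact/eqmodP/asboolP.
Qed.

Lemma lift_layerK g : res_layer (lift_layer g) = g.
Proof. exact: reprK. Qed.

Fact layer_code_subproof : exists f : gal_layer -> 'I_(p ^ n.+1).+1, injective f.
Proof.
have [[z pz]|noz] := pselect (exists z : algC, (p ^ n.+1).-primitive_root z); last first.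
  exists (fun=> ord0) => g h _; rewrite -(lift_layerK g) -(lift_layerK h).
  by apply/res_layerP => x [z [pz _ _]]; case: noz; exists z.
have H g : {i : 'I_(p ^ n.+1) | lift_layer g z = z ^+ i}.
  suff /(prim_rootP pz) : lift_layer g z ^+ (p ^ n.+1) = 1 by [].
  by rewrite -rmorphXn /= prim_expr_order ?rmorph1.
exists (fun g => widen_ord (leqnSn _) (sval (H g))) => g h gh.
rewrite -(lift_layerK g) -(lift_layerK h); apply/res_layerP/(agree_prim pz).
case: (H g) (H h) gh => i gi [j hj] /= [ij].
by rewrite gi hj ij.
Qed.
Definition layer_code := sval (cid layer_code_subproof).
Definition layer_decode i : option gal_layer :=
  if pselect (exists g, layer_code g = i) is left e then Some (sval (cid e)) else None.
Fact layer_codeK : pcancel layer_code layer_decode.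
Proof.
move=> g; rewrite /layer_decode; case: pselect => [e|[]]; last by exists g.
by congr Some; apply: (svalP (cid layer_code_subproof)); apply: (svalP (cid e)).
Qed.
HB.instance Definition _ : isCountable gal_layer := PCanIsCountable layer_codeK.
HB.instance Definition _ : isFinite gal_layer := PCanIsFinite layer_codeK.

Definition lay_one := res_layer 1%g.
Definition lay_mul g h := res_layer (lift_layer g * lift_layer h)%g.
Definition lay_inv g := res_layer (lift_layer g)^-1%g.

Lemma agreeM (s s' t t' : absGalQ) :
  agree_on L s s' -> agree_on L t t' -> agree_on L (s * t)%g (s' * t')%g.
Proof. by move=> ss tt x Lx; rewrite !absgalM tt // ss //; apply: layer_gal. Qed.

Lemma lift_res s : agree_on L (lift_layer (res_layer s)) s.
Proof. by apply/res_layerP; rewrite lift_layerK. Qed.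

Lemma res_mul_ s t : lay_mul (res_layer s) (res_layer t) = res_layer (s * t)%g.
Proof. by apply/res_layerP/agreeM; apply: lift_res. Qed.

Fact lay_mulA : associative lay_mul.
Proof.
move=> g h k; rewrite -(lift_layerK g) -(lift_layerK h) -(lift_layerK k).
by rewrite !res_mul_ mulgA.
Qed.
Fact lay_mul1g : left_id lay_one lay_mul.
Proof. by move=> g; rewrite -(lift_layerK g) res_mul_ mul1g. Qed.
Fact lay_mulVg : left_inverse lay_one lay_inv lay_mul.
Proof. by move=> g; rewrite -{2}(lift_layerK g) res_mul_ mulVg. Qed.

HB.instance Definition _ :=
  Finite_isGroup.Build gal_layer lay_mulA lay_mul1g lay_mulVg.

Lemma res_layerM s t : res_layer (s * t)%g = (res_layer s * res_layer t)%g.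
Proof. by symmetry; apply: res_mul_. Qed.
Lemma res_layer1 : res_layer 1%g = 1%g.
Proof. by []. Qed.
Lemma res_layerV s : res_layer s^-1%g = (res_layer s)^-1%g.
Proof.
have e : (res_layer s^-1 * res_layer s = 1)%g by rewrite -res_layerM mulVg.
by rewrite -[LHS]mulg1 -(mulgV (res_layer s)) mulgA e mul1g.
Qed.
Lemma lay_mulC : commutative (mulg : gal_layer -> gal_layer -> gal_layer).
Proof.
move=> g h; rewrite -(lift_layerK g) -(lift_layerK h) -!res_layerM.
exact/res_layerP/agree_comm.
Qed.
Lemma res_layer_eq1 s : res_layer s = 1%g <-> GalOver L s.
Proof. exact: res_layerP. Qed.
End Layer.

Section LayerProj.
Variables p n : nat.
Definition layer_proj (g : gal_layer p n.+1) : gal_layer p n :=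
  res_layer p n (lift_layer g).
Lemma layer_proj_res s : layer_proj (res_layer p n.+1 s) = res_layer p n s.
Proof. by apply/res_layerP => x Lx; apply/lift_res/layerS. Qed.
Lemma layer_projM g h : layer_proj (g * h)%g = (layer_proj g * layer_proj h)%g.
Proof.
rewrite -(lift_layerK g) -(lift_layerK h) -res_layerM !layer_proj_res.
exact: res_layerM.
Qed.
Lemma layer_proj1 : layer_proj 1%g = 1%g.
Proof. by rewrite -(res_layer1 p n.+1) layer_proj_res. Qed.
End LayerProj.

Section GroupRing.
Variables (O : comNzRingType) (G : finGroupType).
Implicit Types a b c : {ffun G -> O}.

Definition conv a b : {ffun G -> O} := [ffun g => \sum_h a h * b (h^-1 * g)%g].
Definition dirac1 : {ffun G -> O} := [ffun g => (g == 1%g)%:R].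

Lemma convA : associative conv.
Proof.
move=> a b c; apply/ffunP => g; rewrite !ffunE.
under eq_bigr do rewrite ffunE mulr_sumr.
under [RHS]eq_bigr do rewrite ffunE mulr_suml.
rewrite [RHS]exchange_big /=; apply: eq_bigr => h _.
rewrite [RHS](reindex_inj (mulgI h)) /=; apply: eq_bigr => k _.
by rewrite mulrA mulKg invMg mulgA.
Qed.

Lemma conv1l : left_id dirac1 conv.
Proof.
move=> a; apply/ffunP => g; rewrite ffunE (bigD1 1%g) //= big1 => [|h /negPf h1].
  by rewrite ffunE eqxx mul1r addr0 invg1 mul1g.
by rewrite ffunE h1 mul0r.
Qed.

Lemma convDl : left_distributive conv +%R.
Proof.
move=> a b c; apply/ffunP => g; rewrite !ffunE -big_split /=.
by apply: eq_bigr => h _; rewrite ffunE mulrDl.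
Qed.

Lemma convC : commutative (mulg : G -> G -> G) -> commutative conv.
Proof.
move=> GC a b; apply/ffunP => g; rewrite !ffunE.
rewrite (reindex_inj (inj_comp (mulgI g) (@invg_inj G))) /=.
by apply: eq_bigr => h _; rewrite mulrC invMg invgK mulgKV [(g * _)%g]GC.
Qed.

End GroupRing.

(* The completed group ring O[[Gamma]], the inverse limit of the group rings *)
(* O[Gal(Q_n/Q)] with convolution product.                                   *)
Record iwasawa (p : nat) (O : comNzRingType) := Iwasawa {
  iw :> forall n, {ffun gal_layer p n -> O};
  iwP : forall n g, \sum_(h | layer_proj h == g) iw n.+1 h = iw n g }.

Section IwasawaRing.
Variables (p : nat) (O : comNzRingType).
Local Notation L := (iwasawa p O).
HB.instance Definition _ := gen_eqMixin L.
HB.instance Definition _ := gen_choiceMixin L.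
Implicit Types a b c : L.

Lemma iw_eq a b : (forall n, a n = b n) -> a = b.
Proof.
case: a b => [a aP] [b bP] /= ab; have {}ab : a = b by apply: functional_extensionality_dep.
by subst b; rewrite (Prop_irrelevance aP bP).
Qed.

Program Definition iw0 : L := @Iwasawa p O (fun n => 0) _.
Next Obligation. by rewrite ffunE big1 // => h _; rewrite ffunE. Qed.
Program Definition iw_opp a : L := @Iwasawa p O (fun n => - a n) _.
Next Obligation. by rewrite ffunE -iwP -sumrN; apply: eq_bigr => h _; rewrite ffunE. Qed.
Program Definition iw_add a b : L := @Iwasawa p O (fun n => a n + b n) _.
Next Obligation. by rewrite ffunE -!iwP -big_split; apply: eq_bigr => h _; rewrite ffunE. Qed.

Fact iw_addA : associative iw_add.
Proof. by move=> a b c; apply: iw_eq => n; apply: addrA. Qed.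
Fact iw_addC : commutative iw_add.
Proof. by move=> a b; apply: iw_eq => n; apply: addrC. Qed.
Fact iw_add0 : left_id iw0 iw_add.
Proof. by move=> a; apply: iw_eq => n; apply: add0r. Qed.
Fact iw_addN : left_inverse iw0 iw_opp iw_add.
Proof. by move=> a; apply: iw_eq => n; apply: addNr. Qed.
HB.instance Definition _ := GRing.isZmodule.Build L iw_addA iw_addC iw_add0 iw_addN.

Program Definition iw_const (x : O) : L :=
  @Iwasawa p O (fun n => [ffun g => x *+ (g == 1%g)]) _.
Next Obligation.
rewrite ffunE; have [->|g1] := eqVneq g 1%g.
  rewrite (bigD1 1%g) ?layer_proj1 //= ffunE eqxx big1 ?addr0 // => h /andP[_ /negPf h1].
  by rewrite ffunE h1.
rewrite big1 // => h /eqP Dg; rewrite ffunE; case: eqP => // h1.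
by case/eqP: g1; rewrite -Dg h1 layer_proj1.
Qed.

Lemma iw_sum (V : lmodType O) a n (f : gal_layer p n -> V) :
  \sum_h a n.+1 h *: f (layer_proj h) = \sum_g a n g *: f g.
Proof.
rewrite (partition_big (@layer_proj p n) predT) //=; apply: eq_bigr => g _.
rewrite -iwP scaler_suml; apply: eq_bigr => h /eqP <- //.
Qed.

Program Definition iw_mul a b : L := @Iwasawa p O (fun n => conv (a n) (b n)) _.
Next Obligation.
rewrite ffunE; under eq_bigr do rewrite ffunE.
have -> := esym (@iw_sum O^o a n (fun h => b n (h^-1 * g)%g)).
rewrite exchange_big /=; apply: eq_bigr => h _.
rewrite -mulr_sumr; congr (_ * _); rewrite -iwP (reindex_inj (mulgI h)) /=.
apply: eq_big => [k|k _]; last by rewrite mulKg.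
by apply/eqP/eqP => [<-|Dk]; rewrite layer_projM ?mulKg // Dk mulKVg.
Qed.

Fact iw_mulA : associative iw_mul.
Proof. by move=> a b c; apply: iw_eq => n; apply: convA. Qed.
Fact iw_mulC : commutative iw_mul.
Proof. by move=> a b; apply: iw_eq => n; apply/convC/lay_mulC. Qed.
Fact iw_mul1 : left_id (iw_const 1) iw_mul.
Proof. by move=> a; apply: iw_eq => n; apply: conv1l. Qed.
Fact iw_mulDl : left_distributive iw_mul iw_add.
Proof. by move=> a b c; apply: iw_eq => n; apply: convDl. Qed.
Fact iw_1neq0 : iw_const 1 != 0.
Proof.
apply/eqP => /(congr1 (fun a => a 0%N 1%g)); rewrite !ffunE eqxx => /eqP.
by rewrite oner_eq0.
Qed.
HB.instance Definition _ := GRing.Zmodule_isComNzRing.Build L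
  iw_mulA iw_mulC iw_mul1 iw_mulDl iw_1neq0.
End IwasawaRing.

(* A discrete O-module with a continuous O-linear action of Gamma, given as  *)
(* an action of Gal(Qbar/Q): every element is fixed by some Gal(Qbar/Q_n).   *)
Record discrete_module (p : nat) (O : comNzRingType) := DiscreteModule {
  dm_sort :> lmodType O;
  dm_act : absGalQ -> dm_sort -> dm_sort;
  dm_linear : forall s a x y, dm_act s (a *: x + y) = a *: dm_act s x + dm_act s y;
  dm_actM : forall s t x, dm_act (s * t)%g x = dm_act s (dm_act t x);
  dm_smooth : forall x, exists n, forall s, GalOver (cyclo_layer p n) s -> dm_act s x = x }.

Section PontryaginDual.
Variables (p : nat) (O : comNzRingType) (M : discrete_module p O) (D : zmodType).

Local Notation "s • x" := (dm_act s x) (at level 40, left associativity).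

Lemma dm_actD s (x y : M) : s • (x + y) = s • x + s • y.
Proof. by have := dm_linear s 1 x y; rewrite !scale1r. Qed.
Lemma dm_act0 s : s • (0 : M) = 0.
Proof. by apply: (@addrI _ (s • 0)); rewrite -dm_actD !addr0. Qed.
Lemma dm_actZ s a (x : M) : s • (a *: x) = a *: (s • x).
Proof. by have := dm_linear s a x 0; rewrite dm_act0 !addr0. Qed.
Lemma dm_act_sum s I (r : seq I) P (f : I -> M) :
  s • (\sum_(i <- r | P i) f i) = \sum_(i <- r | P i) s • f i.
Proof. by elim/big_rec2: _ => [|i y x _ <-]; rewrite ?dm_act0 ?dm_actD. Qed.

Definition fixed_by n (x : M) := forall s, GalOver (cyclo_layer p n) s -> s • x = x.
Definition level (x : M) : nat := sval (cid (dm_smooth x)).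
Lemma levelP x : fixed_by (level x) x.
Proof. exact: svalP (cid (dm_smooth x)). Qed.

Lemma Gal_layerS n s : GalOver (cyclo_layer p n.+1) s -> GalOver (cyclo_layer p n) s.
Proof. by move=> fs x Lx; apply/fs/layerS. Qed.
Lemma fixed_byS n x : fixed_by n x -> fixed_by n.+1 x.
Proof. by move=> fx s /Gal_layerS/fx. Qed.
Lemma fixed_by_le n m x : (n <= m)%N -> fixed_by n x -> fixed_by m x.
Proof. by move=> /subnK <-; elim: (m - n)%N => //= k IHk /IHk/fixed_byS. Qed.
Lemma fixed_act n x s t : fixed_by n x -> res_layer p n s = res_layer p n t -> s • x = t • x.
Proof.
move=> fx st; rewrite -[s in LHS](mulKVg t) dm_actM fx //.
by apply/res_layer_eq1; rewrite res_layerM res_layerV st mulVg.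
Qed.
Lemma fixed_act_stable n x s : fixed_by n x -> fixed_by n (s • x).
Proof.
move=> fx t ft; rewrite -dm_actM; apply: fixed_act fx _.
by rewrite res_layerM ((res_layer_eq1 p n t).2 ft) mul1g.
Qed.

Definition iw_act_at n (a : iwasawa p O) (x : M) : M :=
  \sum_(g : gal_layer p n) a n g *: ((lift_layer g)^-1%g • x).

Lemma iw_act_atS n a x : fixed_by n x -> iw_act_at n.+1 a x = iw_act_at n a x.
Proof.
move=> fx; rewrite /iw_act_at -(@iw_sum p O M a n (fun g => (lift_layer g)^-1%g • x)).
apply: eq_bigr => h _; congr (_ *: _); apply: fixed_act fx _.
by rewrite !res_layerV lift_layerK.
Qed.
Lemma iw_act_at_le n m a x : (n <= m)%N -> fixed_by n x -> iw_act_at m a x = iw_act_at n a x.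
Proof.
move=> /subnK <-; elim: (m - n)%N => //= k IHk fx; rewrite addSn iw_act_atS ?IHk //.
by apply: fixed_by_le fx; apply: leq_addl.
Qed.

(* Here gamma acts as gamma^-1, so that (gamma f)(x) = f(gamma^-1 x) below. *)
Definition iw_act (a : iwasawa p O) (x : M) : M := iw_act_at (level x) a x.

Lemma iw_actE n a x : fixed_by n x -> iw_act a x = iw_act_at n a x.
Proof.
move=> fx; rewrite /iw_act.
rewrite -(@iw_act_at_le (level x) (maxn (level x) n)) ?leq_maxl //; last exact: levelP.
by rewrite (@iw_act_at_le n) ?leq_maxr.
Qed.

Lemma common_level x y : exists n, fixed_by n x /\ fixed_by n y.
Proof.
exists (maxn (level x) (level y)); split.
  exact/(fixed_by_le (leq_maxl _ _))/levelP.
exact/(fixed_by_le (leq_maxr _ _))/levelP.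
Qed.

Lemma fixed_byD n x y : fixed_by n x -> fixed_by n y -> fixed_by n (x + y).
Proof. by move=> fx fy s Gs; rewrite dm_actD fx ?fy. Qed.

Lemma iw_actDr a : {morph iw_act a : x y / x + y}.
Proof.
move=> x y; have [n [fx fy]] := common_level x y.
rewrite !(@iw_actE n) //; last exact: fixed_byD.
by rewrite -big_split /=; apply: eq_bigr => g _; rewrite dm_actD scalerDr.
Qed.
Lemma iw_actDl x : {morph iw_act^~ x : a b / a + b}.
Proof.
move=> a b; rewrite /iw_act -big_split /=; apply: eq_bigr => g _.
by rewrite ffunE scalerDl.
Qed.
Lemma iw_act1 x : iw_act 1 x = x.
Proof.
rewrite /iw_act /iw_act_at (bigD1 1%g) //= big1 => [|g /negPf g1].
  rewrite ffunE eqxx scale1r addr0 levelP //; apply/res_layer_eq1.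
  by rewrite res_layerV lift_layerK invg1.
by rewrite ffunE g1 scale0r.
Qed.
Lemma fixed_sum n I (r : seq I) (f : I -> M) :
  (forall i, fixed_by n (f i)) -> fixed_by n (\sum_(i <- r) f i).
Proof. by move=> ff s Gs; rewrite dm_act_sum; apply: eq_bigr => i _; apply: ff. Qed.

Lemma iw_act_fixed n a x : fixed_by n x -> fixed_by n (iw_act a x).
Proof.
move=> fx; rewrite (iw_actE a fx); apply: fixed_sum => g s Gs.
by rewrite dm_actZ (fixed_act_stable _ fx).
Qed.

Lemma iw_actM a b x : iw_act a (iw_act b x) = iw_act (a * b) x.
Proof.
have fx := @levelP x; set n := level x in fx *.
rewrite (iw_actE a (iw_act_fixed b fx)) !(iw_actE _ fx) /iw_act_at.
under eq_bigr do rewrite dm_act_sum scaler_sumr.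
transitivity (\sum_g \sum_h (a n g * b n h) *: ((lift_layer (g * h)%g)^-1%g • x)).
  apply: eq_bigr => g _; apply: eq_bigr => h _.
  rewrite dm_actZ scalerA -dm_actM; congr (_ *: _); apply: fixed_act fx _.
  by rewrite res_layerM !res_layerV !lift_layerK invMg lay_mulC.
under [RHS]eq_bigr do rewrite ffunE scaler_suml.
rewrite [RHS]exchange_big /=; apply: eq_bigr => g _.
rewrite [RHS](reindex_inj (mulgI g)) /=; apply: eq_bigr => h _.
by rewrite mulKg.
Qed.

(* Group homomorphisms M -> D; as M is discrete, all are continuous. *)
Record pdual := PDual { pdual_fun :> M -> D; pdualD : {morph pdual_fun : x y / x + y} }.
HB.instance Definition _ := gen_eqMixin pdual.
HB.instance Definition _ := gen_choiceMixin pdual.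

Lemma pdual_eq (f g : pdual) : f =1 g -> f = g.
Proof.
case: f g => [f fP] [g gP] /= /funext fg; subst g.
by rewrite (Prop_irrelevance fP gP).
Qed.

Program Definition pdual0 := @PDual (fun=> 0) _.
Next Obligation. by move=> x y; rewrite addr0. Qed.
Program Definition pdual_opp (f : pdual) := @PDual (fun x => - f x) _.
Next Obligation. by move=> x y; rewrite pdualD opprD. Qed.
Program Definition pdual_add (f g : pdual) := @PDual (fun x => f x + g x) _.
Next Obligation. by move=> x y; rewrite !pdualD addrACA. Qed.
Program Definition pdual_scale (a : iwasawa p O) (f : pdual) :=
  @PDual (fun x => f (iw_act a x)) _.
Next Obligation. by move=> x y; rewrite iw_actDr pdualD. Qed.

Fact pdual_addA : associative pdual_add.
Proof. by move=> f g h; apply: pdual_eq => x; apply: addrA. Qed.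
Fact pdual_addC : commutative pdual_add.
Proof. by move=> f g; apply: pdual_eq => x; apply: addrC. Qed.
Fact pdual_add0 : left_id pdual0 pdual_add.
Proof. by move=> f; apply: pdual_eq => x; apply: add0r. Qed.
Fact pdual_addN : left_inverse pdual0 pdual_opp pdual_add.
Proof. by move=> f; apply: pdual_eq => x; apply: addNr. Qed.
HB.instance Definition _ :=
  GRing.isZmodule.Build pdual pdual_addA pdual_addC pdual_add0 pdual_addN.

Fact pdual_scaleA a b f : pdual_scale a (pdual_scale b f) = pdual_scale (a * b) f.
Proof. by apply: pdual_eq => x; rewrite /= iw_actM mulrC. Qed.
Fact pdual_scale1 : left_id 1 pdual_scale.
Proof. by move=> f; apply: pdual_eq => x; rewrite /= iw_act1. Qed.
Fact pdual_scaleDr : right_distributive pdual_scale +%R.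
Proof. by move=> a f g; apply: pdual_eq. Qed.
Fact pdual_scaleDl f : {morph pdual_scale^~ f : a b / a + b}.
Proof. by move=> a b; apply: pdual_eq => x; rewrite /= iw_actDl pdualD. Qed.
HB.instance Definition _ := GRing.Zmodule_isLmodule.Build (iwasawa p O) pdual
  pdual_scaleA pdual_scale1 pdual_scaleDr pdual_scaleDl.
End PontryaginDual.

Definition padic_val (p : nat) (a : rat) : int :=
  (logn p `|numq a|)%:Z - (logn p `|denq a|)%:Z.
Definition padic_abs (p : nat) (a : rat) : rat :=
  if a == 0 then 0 else p%:R ^ (- padic_val p a).

(* The field Q_p as the completion of Q for the p-adic absolute value;       *)
(* it is determined up to a unique isometric isomorphism.                    *)
Record padic_field (p : nat) := PadicField {
  qp :> fieldType;
  qp_abs : qp -> rat;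
  qp_abs_ge0 : forall x, 0 <= qp_abs x;
  qp_abs_eq0 : forall x, qp_abs x = 0 -> x = 0;
  qp_absM : forall x y, qp_abs (x * y) = qp_abs x * qp_abs y;
  qp_absD : forall x y, qp_abs (x + y) <= Num.max (qp_abs x) (qp_abs y);
  qp_abs_rat : forall a : rat, qp_abs (ratr a) = padic_abs p a;
  qp_dense : forall x (e : rat), 0 < e -> exists a : rat, qp_abs (x - ratr a) < e;
  qp_complete : forall u : nat -> qp,
    (forall e : rat, 0 < e -> exists N, forall m n,
        (N <= m)%N -> (N <= n)%N -> qp_abs (u m - u n) < e) ->
    exists l, forall e : rat, 0 < e -> exists N, forall n,
        (N <= n)%N -> qp_abs (u n - l) < e }.

Section PadicIntegers.
Variables (p : nat) (Q : padic_field p).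

Definition padic_int_pred : pred Q := fun x => qp_abs x <= 1.

Fact padic_int_closed : subring_closed padic_int_pred.
Proof.
have a1 : qp_abs (1 : Q) = 1.
  have nz : qp_abs (1 : Q) != 0.
    by apply/eqP => /qp_abs_eq0/eqP; rewrite oner_eq0.
  by apply: (mulfI nz); rewrite -qp_absM !mulr1.
have aN1 : qp_abs (-1 : Q) = 1.
  have /eqP : qp_abs (-1 : Q) ^+ 2 = 1 by rewrite expr2 -qp_absM mulrNN mulr1.
  by rewrite sqrf_eq1 => /orP[/eqP//|/eqP E]; have := qp_abs_ge0 (-1 : Q); rewrite E.
have E x : (x \in padic_int_pred) = (qp_abs x <= 1) by [].
split=> [|x y|x y]; rewrite !E ?a1 // => x1 y1.
  apply: le_trans (qp_absD _ _) _; rewrite ge_max x1 -mulN1r.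
  by rewrite qp_absM aN1 mul1r.
by rewrite qp_absM mulr_ile1 // qp_abs_ge0.
Qed.
HB.instance Definition _ := GRing.isSubringClosed.Build Q padic_int_pred padic_int_closed.

Definition padic_int := {x : Q | padic_int_pred x}.
HB.instance Definition _ := [isSub of padic_int for sval].
HB.instance Definition _ := Choice.on padic_int.
HB.instance Definition _ := GRing.SubChoice_isSubComNzRing.Build Q padic_int_pred padic_int padic_int_closed.

(* Q_p / Z_p *)
Definition QpZp := Quotient.quot (GRing.ZmodClosed.clone Q padic_int_pred _).
HB.instance Definition _ := GRing.Zmodule.on QpZp.

Section IntegralClosure.
Variables (L : fieldType) (j : {rmorphism Q -> L}).
Definition padic_int_to : {rmorphism padic_int -> L} := (j \o (val : padic_int -> Q)).

Definition intcl : pred L := fun x => `[< integralOver padic_int_to x >].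
Fact intcl_closed : subring_closed intcl.
Proof.
split=> [|x y|x y]; first exact/asboolP/integral1.
  by move=> /asboolP ix /asboolP iy; apply/asboolP/integral_sub.
by move=> /asboolP ix /asboolP iy; apply/asboolP/integral_mul.
Qed.
HB.instance Definition _ := GRing.isSubringClosed.Build L intcl intcl_closed.

Definition int_ring := {x : L | intcl x}.
HB.instance Definition _ := [isSub of int_ring for sval].
HB.instance Definition _ := Choice.on int_ring.
HB.instance Definition _ := GRing.SubChoice_isSubComNzRing.Build L intcl int_ring intcl_closed.

(* The non-units of the integral closure. *)
Definition maxid : set L := [set x | intcl x /\ (x = 0 \/ ~ intcl x^-1)].
End IntegralClosure.
End PadicIntegers.

Section RingOfIntegers.
Variables (p : nat) (Q : padic_field p) (F : fieldExtType Q).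
Definition OF := int_ring (in_alg F).
HB.instance Definition _ := GRing.ComNzRing.on OF.
Definition OFval (a : OF) : F := sval a.

Definition uniformizer (w : OF) :=
  forall a : OF, (maxid (in_alg F) (OFval a)) <-> exists b : OF, a = w * b.

Variable d : nat.
(* An alias of 'rV[F]_d, so that its O-module structure does not clash with *)
(* the F-module one.                                                       *)
Definition OV := 'rV[F]_d.
HB.instance Definition _ := GRing.Zmodule.on OV.
Definition OV_scale (a : OF) (v : OV) : OV := (OFval a) *: (v : 'rV[F]_d).
Fact OV_scaleA a b v : OV_scale a (OV_scale b v) = OV_scale (a * b) v.
Proof. exact: scalerA. Qed.
Fact OV_scale1 : left_id 1 OV_scale.
Proof. exact: scale1r. Qed.
Fact OV_scaleDr : right_distributive OV_scale +%R.
Proof. by move=> a u v; apply: scalerDr. Qed.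
Fact OV_scaleDl v : {morph OV_scale^~ v : a b / a + b}.
Proof. by move=> a b; apply: scalerDl. Qed.
HB.instance Definition _ := GRing.Zmodule_isLmodule.Build OF OV
  OV_scaleA OV_scale1 OV_scaleDr OV_scaleDl.
End RingOfIntegers.

(* Prime ideals above l of the ring Aint of all algebraic integers, that is *)
(* the places of Qbar above l.                                             *)
Definition prime_over (l : nat) (P : set algC) : Prop :=
  [/\ forall x, P x -> x \in Aint,
      forall x y, P x -> P y -> P (x - y),
      forall a x, a \in Aint -> P x -> P (a * x),
      forall x y, x \in Aint -> y \in Aint -> P (x * y) -> P x \/ P y
    & P l%:R /\ ~ P 1].

Definition gal_prime (s : absGalQ) (P : set algC) : set algC :=
  [set x | P (s^-1%g x)].

Definition decomposition (P : set algC) : set absGalQ := [set s | gal_prime s P = P].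

Definition inertia (P : set algC) : set absGalQ :=
  [set s | decomposition P s /\ forall x, x \in Aint -> P (s x - x)].

(* Q_Sigma, as the common fixed field of the inertia groups at all primes    *)
(* outside Sigma, for Sigma made of the infinite place and S. *)
Definition max_unram (S : seq nat) : set algC :=
  [set x | forall l P, prime l -> l \notin S -> prime_over l P ->
     forall s, inertia P s -> s x = x].

Lemma Aint_gal (s : absGalQ) x : (s x \in Aint) = (x \in Aint).
Proof. exact: Aint_aut. Qed.

Lemma gal_primeE s P x : gal_prime s P x = P (s^-1%g x). Proof. by []. Qed.

Lemma gal_primeM s t P : gal_prime (s * t)%g P = gal_prime s (gal_prime t P).
Proof. by apply/funext => x; rewrite !gal_primeE invMg absgalM. Qed.
Lemma gal_prime1 P : gal_prime 1%g P = P.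
Proof. by apply/funext => x; rewrite gal_primeE invg1. Qed.

Lemma prime_over_gal l P s : prime_over l P -> prime_over l (gal_prime s P).
Proof.
move=> [PA PB PM Pp [Pl P1]]; split.
- by move=> x; rewrite gal_primeE => /PA; rewrite Aint_gal.
- by move=> x y; rewrite !gal_primeE rmorphB; apply: PB.
- by move=> a x Aa; rewrite !gal_primeE rmorphM; apply: PM; rewrite ?Aint_gal.
- by move=> x y Ax Ay; rewrite !gal_primeE rmorphM; apply: Pp; rewrite Aint_gal.
- by rewrite !gal_primeE rmorph_nat rmorph1.
Qed.

Lemma inertia_conj P (s t : absGalQ) :
  inertia (gal_prime t P) s <-> inertia P (t^-1 * s * t)%g.
Proof.
rewrite /inertia /decomposition /mkset !gal_primeM; split=> [[sP sx]|[sP sx]]; split.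
- by rewrite sP -gal_primeM mulVg gal_prime1.
- move=> x Ax; have := sx (t x); rewrite Aint_gal => /(_ Ax).
  by rewrite gal_primeE rmorphB !absgalM absgalK.
- by rewrite -[in RHS]sP -!gal_primeM !mulgA mulgV mul1g.
- move=> x Ax; have := sx (t^-1%g x); rewrite Aint_gal => /(_ Ax).
  by rewrite gal_primeE rmorphB !absgalM absgalVK.
Qed.

Lemma max_unram_gal S (s : absGalQ) x : max_unram S x -> max_unram S (s x).
Proof.
move=> ux l P pl lS Pl t tP.
have tP' : inertia (gal_prime s^-1%g P) (s^-1 * t * s)%g.
  by apply/inertia_conj; rewrite invgK !mulgA mulgV mul1g mulgK.
by have := ux l _ pl lS (prime_over_gal s^-1%g Pl) _ tP'; rewrite !absgalM => /(congr1 s); rewrite absgalVK.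
Qed.

Section NumberField.
Variables (K : splittingFieldType rat) (iK : {rmorphism K -> algC}).

Definition gal_res (s : absGalQ) : gal_of {:K} :=
  odflt 1%g [pick g in 'Gal({:K} / 1)%g | `[< forall x, iK (g x) = s (iK x) >]].

Lemma gal_resP s x : iK (gal_res s x) = s (iK x).
Proof.
have [f fP] := restrict_aut_to_normal_num_field iK s.
have hf : kHom 1 {:K} (linfun f).
  apply/kHomP; split=> [a b _ _|_ /vlineP[a ->]]; rewrite !lfunE /= ?rmorphM //.
  by rewrite linearZ /= rmorph1.
have /kAut_to_gal[g gK fg] : kAut 1 {:K} (linfun f) by rewrite kAutfE.
rewrite /gal_res; case: pickP => [h /andP[_ /asboolP ->]//|/(_ g)/negP[]].
apply/andP; split=> //; apply/asboolP => y.
by rewrite -fg ?memvf // lfunE /= fP.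
Qed.

Lemma gal_res_in s : gal_res s \in 'Gal({:K} / 1)%g.
Proof. by rewrite /gal_res; case: pickP => [h /andP[]|_] //=; apply: group1. Qed.

Lemma gal_resM s t : gal_res (s * t)%g = (gal_res t * gal_res s)%g.
Proof.
apply/eqP/gal_eqP => x _; apply: (fmorph_inj iK).
by rewrite galM ?memvf // !gal_resP.
Qed.

Lemma gal_res1 : gal_res 1%g = 1%g.
Proof.
apply/eqP/gal_eqP => x _; apply: (fmorph_inj iK).
by rewrite gal_resP gal_id.
Qed.

Definition cconj : gal_of {:K} := gal_res (Num.conj : {rmorphism algC -> algC}).

(* K/Q is Galois, so l is unramified in K iff the inertia groups of the      *)
(* primes above l act trivially on K.                                        *)
Definition ramified_in (l : nat) :=
  exists P, prime_over l P /\ exists s, inertia P s /\ gal_res s != 1%g.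

(* Decomposition group in Gal(K/Q) of the prime ideal iK^-1(P) of K. *)
Definition decK (P : set algC) : {set gal_of {:K}} :=
  [set g in 'Gal({:K} / 1)%g | `[< forall x, P (iK (g x)) <-> P (iK x) >]].
Fact decK_group_set P : group_set (decK P).
Proof.
apply/group_setP; split=> [|g h].
  by rewrite inE group1; apply/asboolP => x; rewrite gal_id.
rewrite !inE => /andP[gG /asboolP gP] /andP[hG /asboolP hP].
by rewrite groupM //; apply/asboolP => x; rewrite galM ?memvf // hP gP.
Qed.
Canonical decK_group P := Group (decK_group_set P).
Lemma decK_sub P : decK P \subset 'Gal({:K} / 1)%g.
Proof. by apply/fintype.subsetP => g; rewrite inE => /andP[]. Qed.
End NumberField.

Definition place_prime p (Q : padic_field p) (Qbar : fieldType)
    (j : {rmorphism Q -> Qbar}) (i : {rmorphism algC -> Qbar}) : set algC :=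
  [set x | x \in Aint /\ maxid j (i x)].

Section Selmer.
Variables (p : nat) (Q : padic_field p) (F : fieldExtType Q).
Variables (K : splittingFieldType rat) (iK : {rmorphism K -> algC}).
Variables (d : nat) (rG : mx_representation F 'Gal({:K} / 1)%g d).

Record stable_lattice := StableLattice {
  lat :> OV F d -> Prop;
  lat_gen : exists m (B : 'M[F]_(m, d)), row_full B /\
    forall v, lat v <-> exists a : 'I_m -> OF F, v = \sum_i OFval (a i) *: row i B;
  lat_stable : forall g v, g \in 'Gal({:K} / 1)%g -> lat v -> lat (v *m rG g) }.

Variable T : stable_lattice.

Fact lat0 : T 0.
Proof.
have [m [B [_ TB]]] := lat_gen T; apply/TB; exists (fun=> 0).
by rewrite big1 // => i _; rewrite scale0r.
Qed.
Fact lat_lin a (u v : OV F d) : T u -> T v -> T (a *: u + v).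
Proof.
have [m [B [_ TB]]] := lat_gen T; move=> /TB[x ->] /TB[y ->]; apply/TB.
exists (fun i => a * x i + y i); rewrite [_ *: _]scaler_sumr -big_split /=.
by apply: eq_bigr => i _; rewrite scalerA -scalerDl.
Qed.
Definition lat_submod : submodule (OV F d) := Submodule lat0 lat_lin.

Definition lat_quot := quotmod lat_submod.
HB.instance Definition _ := GRing.Lmodule.on lat_quot.
HB.instance Definition _ := EqQuotient.on lat_quot.
Local Notation A := lat_quot.

(* mathcomp composes Galois automorphisms in diagrammatic order and rG acts  *)
(* on row vectors on the right, so this is a left action of Gal(Qbar/Q).     *)
Definition galV (s : absGalQ) (v : OV F d) : OV F d := v *m rG (gal_res iK s).
Definition galA (s : absGalQ) (x : A) : A := qpi lat_submod (galV s (qrep x)).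

Lemma galV_lin s a u v : galV s (a *: u + v) = a *: galV s u + galV s v.
Proof. by rewrite /galV mulmxDl -scalemxAl. Qed.
Lemma galVB s u v : galV s (u - v) = galV s u - galV s v.
Proof. exact: mulmxBl. Qed.
Lemma galA_pi s v : galA s (qpi lat_submod v) = qpi lat_submod (galV s v).
Proof.
apply/qpiP; rewrite -galVB; apply: lat_stable; first exact: gal_res_in.
by apply/(@qpiP _ _ lat_submod); rewrite qpiK.
Qed.
Lemma galA_lin s a x y : galA s (a *: x + y) = a *: galA s x + galA s y.
Proof.
rewrite -[x](@qpiK _ _ lat_submod) -[y](@qpiK _ _ lat_submod).
have E b u v : b *: qpi lat_submod u + qpi lat_submod v = qpi lat_submod (b *: u + v).
  by rewrite raddfD -qpiZ.
by rewrite E !galA_pi galV_lin E.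
Qed.
Lemma galAM s t x : galA (s * t)%g x = galA s (galA t x).
Proof.
rewrite -[x](@qpiK _ _ lat_submod) !galA_pi; congr qpi.
by rewrite /galV gal_resM repr_mxM ?gal_res_in // mulmxA.
Qed.
Lemma galA1 x : galA 1%g x = x.
Proof.
rewrite -[x](@qpiK _ _ lat_submod) galA_pi; congr qpi.
by rewrite /galV gal_res1 repr_mx1 mulmx1.
Qed.
Lemma galAD s x y : galA s (x + y) = galA s x + galA s y.
Proof. by have := galA_lin s 1 x y; rewrite !scale1r. Qed.
Lemma galA0 s : galA s 0 = 0.
Proof. by apply: (@addrI _ (galA s 0)); rewrite -galAD !addr0. Qed.
Lemma galAB s x y : galA s (x - y) = galA s x - galA s y.
Proof. by rewrite addrC -scaleN1r galA_lin scaleN1r addrC. Qed.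

Variables (P0 : set algC) (W : 'M[F]_d) (S : seq nat).

Definition Aplus : set A :=
  [set x | exists v : OV F d, (v <= W)%MS /\ x = qpi lat_submod v].

Local Notation G n := (GalOver (cyclo_layer p n)).
Local Notation cochain := (absGalQ -> A).
Implicit Type c : cochain.

(* Cochains on Gal(Qbar/Q_n) are represented by functions on Gal(Qbar/Q)     *)
(* whose values outside Gal(Qbar/Q_n) are ignored: functions that agree on   *)
(* Gal(Qbar/Q_n) have the same class modulo [coboundary n] below, and        *)
(* restriction from Q_n to Q_(n+1) is the identity on representatives.       *)
Definition cocycle n c := forall s t, G n s -> G n t -> c (s * t)%g = c s + galA s (c t).

(* c factors through Gal(Q_Sigma/Q_n) and is locally constant there: c s only *)
(* depends on the values of s at finitely many elements of Q_Sigma.           *)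
Definition factors n c := exists r : seq algC, (forall x, x \in r -> max_unram S x) /\
  forall s t, G n s -> G n t -> (forall x, x \in r -> s x = t x) -> c s = c t.

(* The class of c in H^1(H, A / B) vanishes. *)
Definition trivial_on (H : set absGalQ) (B : set A) c :=
  exists a, forall s, H s -> B (c s - (galA s a - a)).

(* c represents a class of Sel_(Q_n) in H^1(Q_Sigma/Q_n, A). The inertia     *)
(* group of Qbar/Q_n at a prime P of Qbar is [inertia P `&` G n]. Conditions *)
(* at primes of Qbar over the same prime of Q_n are equivalent for a cocycle *)
(* on G n, so they are imposed at all of them; at the prime t(P0) above p,   *)
(* A^+ is transported by t. As p is totally ramified in Q_n, all the t(P0)   *)
(* lie over the prime p_n, and the last condition is the one at P0.          *)
Definition selmer n c :=
  [/\ cocycle n c, factors n c,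
      forall l P, l \in S -> l != p -> prime_over l P ->
        trivial_on (inertia P `&` G n) [set 0] c
    & forall t, trivial_on (inertia (gal_prime t P0) `&` G n) (galA t @` Aplus) c].

Lemma G1 n : G n 1%g. Proof. by []. Qed.
Lemma GM n s t : G n s -> G n t -> G n (s * t)%g.
Proof. by move=> /res_layer_eq1 s1 /res_layer_eq1 t1; apply/res_layer_eq1; rewrite res_layerM s1 t1 mulg1. Qed.
Lemma GV n s : G n s -> G n s^-1%g.
Proof. by move=> /res_layer_eq1 s1; apply/res_layer_eq1; rewrite res_layerV s1 invg1. Qed.
Lemma GJ n s t : G n s -> G n (t^-1 * s * t)%g.
Proof.
move=> /res_layer_eq1 s1; apply/res_layer_eq1.
by rewrite !res_layerM res_layerV s1 mulg1 mulVg.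
Qed.

Lemma trivialS (H H' : set absGalQ) B c : H' `<=` H -> trivial_on H B c -> trivial_on H' B c.
Proof. by move=> HH [a Ha]; exists a => s /HH; apply: Ha. Qed.

Lemma trivial_lin H (B : set A) k c c' :
  (forall k x y, B x -> B y -> B (k *: x + y)) ->
  trivial_on H B c -> trivial_on H B c' -> trivial_on H B (k *: c + c').
Proof.
move=> BL [a Ha] [b Hb]; exists (k *: a + b) => s Hs.
rewrite -[(k *: c + c') s]/(k *: c s + c' s) galA_lin.
have -> : k *: c s + c' s - (k *: galA s a + galA s b - (k *: a + b)) =
    k *: (c s - (galA s a - a)) + (c' s - (galA s b - b)).
  by rewrite (opprD (k *: a)) addrACA opprD addrACA !scalerBr.
by apply: BL; [apply: Ha|apply: Hb].
Qed.

Lemma Aplus_lin k x y : Aplus x -> Aplus y -> Aplus (k *: x + y).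
Proof.
move=> [u [uW ->]] [v [vW ->]]; exists (k *: u + v); split.
  by apply: addmx_sub => //; apply: scalemx_sub.
by rewrite raddfD -qpiZ.
Qed.

Lemma galAplus_lin t k x y :
  (galA t @` Aplus) x -> (galA t @` Aplus) y -> (galA t @` Aplus) (k *: x + y).
Proof.
move=> [u uA <-] [v vA <-]; exists (k *: u + v); first exact: Aplus_lin.
exact: galA_lin.
Qed.

Lemma selmer_lin n k c c' : selmer n c -> selmer n c' -> selmer n (k *: c + c').
Proof.
move=> [c1 [r [rS rc]] cl cp] [c1' [r' [rS' rc']] cl' cp']; split.
- move=> s t Gs Gt; rewrite -[LHS]/(k *: c _ + c' _) c1 // c1' //.
  by rewrite -[(k *: c + c') s]/(k *: c s + c' s) -[(k *: c + c') t]/(k *: c t + c' t)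
    galA_lin scalerDr addrACA.
- exists (r ++ r'); split=> [x|s t Gs Gt st].
    by rewrite mem_cat => /orP[/rS|/rS'].
  rewrite -[LHS]/(k *: c _ + c' _) -[RHS]/(k *: c _ + c' _).
  by rewrite (rc s t) ?(rc' s t) // => x xr; apply: st; rewrite mem_cat xr ?orbT.
- move=> l P lS lp Pl; apply: trivial_lin (cl l P lS lp Pl) (cl' l P lS lp Pl).
  by move=> h x y -> ->; rewrite scaler0 addr0.
- by move=> t; apply: trivial_lin (cp t) (cp' t) => *; apply: galAplus_lin.
Qed.

Lemma selmer0 n : selmer n 0.
Proof.
split.
- by move=> s t _ _; rewrite galA0 addr0.
- by exists [::].
- by move=> l P _ _ _; exists 0 => s _; rewrite galA0 subrr subr0.
- move=> t; exists 0 => s _; rewrite galA0 subrr subr0.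
  exists 0; last exact: galA0.
  by exists 0; split; rewrite ?sub0mx // raddf0.
Qed.

Lemma selmerS n c : selmer n c -> selmer n.+1 c.
Proof.
have GS s : G n.+1 s -> G n s by move=> fs x Lx; apply/fs/layerS.
move=> [c1 [r [rS rc]] cl cp]; split.
- by move=> s t /GS Gs /GS Gt; apply: c1.
- by exists r; split=> // s t /GS Gs /GS Gt; apply: rc.
- move=> l P lS lp Pl; apply: trivialS (cl l P lS lp Pl) => s [Is /GS Gs]; by [].
- move=> t; apply: trivialS (cp t) => s [Is /GS Gs]; by [].
Qed.

Lemma selmer_le n m c : (n <= m)%N -> selmer n c -> selmer m c.
Proof. by move=> /subnK <-; elim: (m - n)%N => //= k IHk /IHk/selmerS. Qed.

Definition coboundary n c := trivial_on (G n) [set 0] c.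

Lemma coboundary_le n m c : (n <= m)%N -> coboundary n c -> coboundary m c.
Proof.
move=> /subnK <-; elim: (m - n)%N => //= k IHk /IHk; apply: trivialS => s fs x Lx.
exact/fs/layerS.
Qed.

Fact cobnd0 : exists n, coboundary n 0.
Proof. by exists 0%N, 0 => s _; rewrite galA0 subrr subr0. Qed.
Fact cobnd_lin k c c' : (exists n, coboundary n c) -> (exists n, coboundary n c') ->
  exists n, coboundary n (k *: c + c').
Proof.
move=> [n cn] [n' cn']; exists (maxn n n').
apply: trivial_lin; last exact: coboundary_le (leq_maxr _ _) cn'.
  by move=> h x y -> ->; rewrite scaler0 addr0.
exact: coboundary_le (leq_maxl _ _) cn.
Qed.
Definition coboundaries : submodule cochain := Submodule cobnd0 cobnd_lin.

(* In this quotient the classes of Selmer cocycles form the direct limit of  *)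
(* the groups Sel_(Q_n), since both cocycles and coboundaries of level n are *)
(* among those of level n + 1; see [selmer_limP].                            *)
Definition cochain_mod := quotmod coboundaries.
HB.instance Definition _ := GRing.Lmodule.on cochain_mod.
HB.instance Definition _ := EqQuotient.on cochain_mod.
Local Notation cls := (qpi coboundaries).

Lemma selmer_limP n m c c' : selmer n c -> selmer m c' ->
  cls c = cls c' <->
    exists k, [/\ (n <= k)%N, (m <= k)%N & coboundary k (c - c')].
Proof.
move=> _ _; split=> [/qpiP[k ck]|[k [_ _ ck]]]; last by apply/qpiP; exists k.
exists (maxn k (maxn n m)); split; last exact: coboundary_le (leq_maxl _ _) ck.
  by rewrite !leq_max leqnn orbT.
by rewrite !leq_max leqnn !orbT.
Qed.

Definition selmer_set : cochain_mod -> Prop := fun x => exists n c, selmer n c /\ x = cls c.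
Fact selmer_set0 : selmer_set 0.
Proof. by exists 0%N, 0; split; [apply: selmer0|rewrite raddf0]. Qed.
Fact selmer_set_lin k x y : selmer_set x -> selmer_set y -> selmer_set (k *: x + y).
Proof.
move=> [n [c [cn ->]]] [n' [c' [cn' ->]]]; exists (maxn n n'), (k *: c + c'); split.
  by apply: selmer_lin; [apply: selmer_le cn; apply: leq_maxl|apply: selmer_le cn'; apply: leq_maxr].
by rewrite raddfD -qpiZ.
Qed.
Definition selmer_submod : submodule cochain_mod := Submodule selmer_set0 selmer_set_lin.

Definition Sel := submod_type selmer_submod.
HB.instance Definition _ := GRing.Lmodule.on Sel.

Definition cact (t : absGalQ) c : cochain := fun s => galA t (c (t^-1 * s * t)%g).

Lemma trivial_cact (H H' : set absGalQ) (B : set A) t c :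
  (forall s, H' s -> H (t^-1 * s * t)%g) ->
  trivial_on H B c -> trivial_on H' (galA t @` B) (cact t c).
Proof.
move=> HH [a Ha]; exists (galA t a) => s Hs; exists (c (t^-1 * s * t)%g - (galA (t^-1 * s * t)%g a - a)).
  exact/Ha/HH.
by rewrite /cact !galAB -!galAM !mulgA mulgV mul1g.
Qed.

Lemma selmer_cact n t c : selmer n c -> selmer n (cact t c).
Proof.
move=> [c1 [r [rS rc]] cl cp]; split.
- move=> s s' Gs Gs'; rewrite /cact.
  have -> : (t^-1 * (s * s') * t = (t^-1 * s * t) * (t^-1 * s' * t))%g.
    by rewrite !mulgA mulgK.
  by rewrite c1 ?galAD -?galAM ?mulgA ?mulgV ?mul1g //; apply: GJ.
- exists (map t r); split=> [_ /mapP[x /rS xS ->]|s s' Gs Gs' ss]; first exact: max_unram_gal.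
  rewrite /cact (rc _ (t^-1 * s' * t)%g) //; try exact: GJ.
  by move=> x xr; rewrite !absgalM ss ?map_f.
- move=> l P lS lp Pl.
  have [|a Ha] := @trivial_cact _ (inertia P `&` G n) _ t _ _ (cl l _ lS lp (prime_over_gal t^-1%g Pl)).
    move=> s [Is Gs]; split; last exact: GJ.
    by apply: (inertia_conj _ _ _).1; rewrite -gal_primeM mulgV gal_prime1.
  by exists a => s Hs; have [x -> <-] := Ha s Hs; rewrite galA0.
- move=> t'.
  have [|a Ha] := @trivial_cact _ (inertia (gal_prime t' P0) `&` G n) _ t _ _ (cp (t^-1 * t')%g).
    move=> s [Is Gs]; split; last exact: GJ.
    by apply: (inertia_conj _ _ _).1; rewrite -gal_primeM mulKVg.
  exists a => s Hs; have [_ [x xA <-] <-] := Ha s Hs; exists x => //.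
  by rewrite -galAM mulKVg.
Qed.

Lemma coboundary_cact n t c : coboundary n c -> coboundary n (cact t c).
Proof.
move=> cn; have [|a Ha] := @trivial_cact _ (G n) _ t _ _ cn; first by move=> s; apply: GJ.
by exists a => s Hs; have [x -> <-] := Ha s Hs; rewrite galA0.
Qed.

Lemma cact_lin t k c c' : cact t (k *: c + c') = k *: cact t c + cact t c'.
Proof. by apply/funext => s; apply: galA_lin. Qed.
Lemma cactB t c c' : cact t (c - c') = cact t c - cact t c'.
Proof. by apply/funext => s; apply: galAB. Qed.
Lemma cactM s t c : cact (s * t)%g c = cact s (cact t c).
Proof. by apply/funext => u; rewrite /cact galAM invMg !mulgA. Qed.

Definition mact t (x : cochain_mod) : cochain_mod := cls (cact t (qrep x)).
Lemma mact_cls t c : mact t (cls c) = cls (cact t c).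
Proof.
apply/qpiP; rewrite -cactB.
have /qpiP[n cn] := qpiK (cls c); exists n; exact: coboundary_cact.
Qed.

Fact sel_act_subproof t (x : Sel) : submod_pred selmer_submod (mact t (sval x)).
Proof.
case: x => _ /= /asboolP[n [c [cn ->]]]; apply/asboolP; exists n, (cact t c).
by rewrite mact_cls; split=> //; apply: selmer_cact.
Qed.
Definition sel_act t (x : Sel) : Sel := 
  @exist _ (submod_pred selmer_submod) _ (sel_act_subproof t x).

Fact sel_act_lin t k (x y : Sel) : sel_act t (k *: x + y) = k *: sel_act t x + sel_act t y.
Proof.
have vE (u v : Sel) : sval (k *: u + v) = k *: sval u + sval v.
  exact: (linearP (val : submod_type selmer_submod -> cochain_mod)).
apply: val_inj; change (mact t (sval (k *: x + y)) = sval (k *: sel_act t x + sel_act t y)).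
rewrite !vE.
case: x y => _ /= /asboolP[n [c [cn ->]]] [_ /= /asboolP[m [c' [cm ->]]]].
have E b u v : b *: cls u + cls v = cls (b *: u + v) by rewrite raddfD -qpiZ.
by rewrite E !mact_cls E cact_lin.
Qed.
Fact sel_actM s t x : sel_act (s * t)%g x = sel_act s (sel_act t x).
Proof.
apply: val_inj; case: x => _ /= /asboolP[n [c [cn ->]]].
by rewrite !mact_cls cactM.
Qed.
Fact sel_smooth x : exists n, forall s, GalOver (cyclo_layer p n) s -> sel_act s x = x.
Proof.
case: x => x xP; have /asboolP[n [c [[c1 _ _ _] Dx]]] := xP; exists n => t Gt.
apply: val_inj; rewrite /= Dx mact_cls; apply/qpiP; exists n, (c t) => s Gs.
rewrite -[(cact t c - c) s]/(cact t c s - c s) /cact.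
have c10 : c 1%g = 0.
  have := c1 1%g 1%g (@G1 n) (@G1 n); rewrite mulg1 galA1 => /eqP.
  by rewrite -[X in X == _]addr0 (inj_eq (addrI _)) => /eqP.
have ctV : galA t (c t^-1%g) = - c t.
  by apply/eqP; rewrite -addr_eq0 addrC -(c1 _ _ Gt (GV Gt)) mulgV c10.
rewrite -mulgA (c1 _ _ (GV Gt) (GM Gs Gt)) galAD ctV.
rewrite -galAM mulgV galA1 c1 // (addrC (c s)) addrA addrK opprB.
by rewrite addrACA addNr subrr addr0.
Qed.

(* Sel_(Q_oo)(A, A^+) *)
Definition Sel_GV : discrete_module p (OF F) :=
  DiscreteModule sel_act_lin sel_actM sel_smooth.

Definition X_GV := pdual Sel_GV (QpZp Q).
HB.instance Definition _ := GRing.Lmodule.on X_GV.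
End Selmer.

Section ModuleInvariants.
Variables (R : comNzRingType) (M : lmodType R).

Definition fin_gen := exists n (x : 'I_n -> M),
  forall y, exists a : 'I_n -> R, y = \sum_i a i *: x i.

Definition torsion := forall x : M, exists a : R, a != 0 /\ a *: x = 0.

Definition principal (f : R) : set R := [set a | exists b, a = b * f].

Definition prime_elt (q : R) :=
  [/\ q != 0, ~ principal q 1
    & forall a b, principal q (a * b) -> principal q a \/ principal q b].

Section Elementary.
Variables (n : nat) (f : 'I_n -> R).
Fact elem_rel0 (i : 'I_n) : principal (f i) ((0 : 'rV[R]_n) ord0 i).
Proof. by exists 0; rewrite mul0r mxE. Qed.
Fact elem_rel_lin k (u v : 'rV[R]_n) :
  (forall i, principal (f i) (u ord0 i)) -> (forall i, principal (f i) (v ord0 i)) ->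
  forall i, principal (f i) ((k *: u + v) ord0 i).
Proof.
move=> fu fv i; have [[a ua] [b vb]] := (fu i, fv i); exists (k * a + b).
by rewrite !mxE ua vb mulrDl mulrA.
Qed.
Definition elem_rel : submodule 'rV[R]_n :=
  @Submodule R _ (fun v : 'rV[R]_n => forall i, principal (f i) (v ord0 i))
    elem_rel0 elem_rel_lin.

(* The direct sum of the modules R / (f i). *)
Definition elem_mod := quotmod elem_rel.
HB.instance Definition _ := GRing.Lmodule.on elem_mod.

Variable phi : {linear M -> elem_mod}.
Fact im0 : exists x, phi x = 0. Proof. by exists 0; rewrite raddf0. Qed.
Fact im_lin k u v : (exists x, phi x = u) -> (exists x, phi x = v) ->
  exists x, phi x = k *: u + v.
Proof. by move=> [x <-] [y <-]; exists (k *: x + y); rewrite linearP. Qed.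
Definition im_submod : submodule elem_mod := Submodule im0 im_lin.
End Elementary.

(* Over a two-dimensional regular local ring with finite residue field such  *)
(* as O[[Gamma]], the finitely generated pseudo-null modules are the finite  *)
(* ones.                                                                     *)
Definition pseudo_iso n (f : 'I_n -> R) := exists phi : {linear M -> elem_mod f},
  finite_set [set x | phi x = 0] /\ finite_set [set: quotmod (im_submod phi)].

(* By the structure theorem the ideal generated by the product of the q i ^ k i *)
(* exists and does not depend on the decomposition.                             *)
Definition char_ideal : set R := [set a |
  exists n (q : 'I_n -> R) (k : 'I_n -> nat),
    [/\ forall i, prime_elt (q i), pseudo_iso (fun i => q i ^+ k i)
      & principal (\prod_i q i ^+ k i) a]].

(* The largest n with char_ideal contained in (w ^ n); 0 if there is none. *)
Definition mu_invariant (w : R) : nat := xget 0%N [set n |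
  char_ideal `<=` principal (w ^+ n) /\
  forall m, char_ideal `<=` principal (w ^+ m) -> (m <= n)%N].
End ModuleInvariants.

Section Constituents.
Variables (F : fieldType) (gT : finGroupType) (H : {group gT}).

(* rS is a subquotient of rH; section_repr modU modV is the action on V / U. *)
Definition constituent m (rS : mx_representation F H m)
    n (rH : mx_representation F H n) : Prop :=
  exists (U V : 'M[F]_n) (modU : mxmodule rH U) (modV : mxmodule rH V),
    (U <= V)%MS /\ mx_rsim rS (section_repr modU modV).

Definition disjoint_constituents n1 (r1 : mx_representation F H n1)
    n2 (r2 : mx_representation F H n2) : Prop :=
  forall m (rS : mx_representation F H m), mx_irreducible rS ->
    constituent rS r1 -> ~ constituent rS r2.
End Constituents.

(* The trivial representation occurs in the restriction of rG to <[cconj]>,  *)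
(* a decomposition group at infinity, with multiplicity the dimension of the *)
(* space of invariants.                                                      *)
Definition dplus (p : nat) (Q : padic_field p) (F : fieldExtType Q)
    (K : splittingFieldType rat) (iK : {rmorphism K -> algC}) (d : nat)
    (rG : mx_representation F 'Gal({:K} / 1)%g d) : nat :=
  \rank (rfix_mx rG <[cconj iK]>%g).

(* Main.v *)
Require Import Defs.
From HB Require Import structures.
From mathcomp Require Import all_boot all_order all_algebra all_fingroup.
From mathcomp Require Import all_solvable all_field all_character.
From mathcomp Require Import ring.
From mathcomp Require Import boolp classical_sets functions cardinality.

Set Implicit Arguments.
Unset Strict Implicit.
Unset Printing Implicit Defensive.

Import Order.TTheory GRing.Theory Num.Theory.
Local Open Scope ring_scope.

(* Since p does not divide #|Delta|, the reduction modulo the uniformizer of a stable lattice in an *)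
(* irreducible representation is irreducible, so any two stable lattices are homothetic: T1 = c T.   *)
(* Multiplication by c is then an isomorphism of A = V / T onto A1 = V / T1 compatible with the       *)
(* Galois action and with A^+, hence induces isomorphisms of Selmer groups and of their duals.        *)
(* For the homothety, take bases of T and T1 that are proportional, and let E be the projection onto *)
(* the coordinates where the factor has minimal valuation. The average of E over Delta is idempotent *)
(* modulo the uniformizer and commutes with Delta; by completeness it lifts to an equivariant        *)
(* idempotent, which is 0 or 1 by Schur's lemma, so all the factors have the same valuation.         *)

(** The characteristic ideal is defined through pseudo-isomorphisms, hence is an isomorphism
    invariant. A homothety [T1 = c T] makes the two Selmer duals isomorphic over the Iwasawa algebra
    ([char_ideal_homothetic]), so everything rests on [stable_lattices_homothetic].

    By elementary divisors ([lattice_adapted_basis]), some basis of [T] rescaled by factors [f i] is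
    a basis of [T1]. Stability of both lattices says that Delta acts in this basis by matrices [r]
    with [r i j] and [f i * r i j / f j] integral. So [r i j] is divisible by the uniformizer when
    [f i] has minimal valuation and [f j] does not: modulo the uniformizer the minimal coordinates
    span a stable subspace. Averaging over Delta, whose order is a unit, and Newton iteration
    ([newton_lift]) turn the projection onto it into an equivariant idempotent
    ([averaged_idempotent]), and Schur's lemma forces this subspace to be everything
    ([adapted_basis_equal]).

    The argument needs the integral closure [O] of Z_p in F to be a complete discrete valuation
    ring. This is derived from the axioms of [padic_field] and the given uniformizer:
    [intcl_p_complete], [uniformizer_sep], [intcl_total], [uniformizer_complete]. *)

Lemma invmx_uniq (R : comUnitRingType) n (A B : 'M[R]_n) : A *m B = 1%:M -> invmx A = B.
Proof.
move=> AB; have [uA _] := mulmx1_unit AB.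
by apply: (can_inj (mulKmx uA)); rewrite mulmxV.
Qed.

Lemma invmx_mul (R : comUnitRingType) n (A B : 'M[R]_n) : A \in unitmx -> B \in unitmx ->
  invmx (A *m B) = invmx B *m invmx A.
Proof. by move=> uA uB; apply: invmx_uniq; rewrite mulmxA mulmxK // mulmxV. Qed.

(** * Lattices and elementary divisors over a valuation ring *)

Section ValuationRing.
Variables (F : fieldType) (O : subringClosed F).
Hypothesis O_total : forall x, (x \in O) || (x^-1 \in O).

Definition row_span m n (M : 'M[F]_(m, n)) (v : 'rV[F]_n) :=
  exists2 a : 'rV_m, a \is a mxOver O & v = a *m M.

(** The group GL_n(O), kept inside matrices over [F] so that it multiplies with non-integral
    ones. *)
Definition unimodular n (R : 'M[F]_n) :=
  [/\ R \in unitmx, R \is a mxOver O & invmx R \is a mxOver O].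

Lemma unimodular1 n : unimodular (1%:M : 'M_n).
Proof. by split; rewrite ?invmx1 ?unitmx1 ?mxOver_scalar ?rpred0 ?rpred1. Qed.

Lemma unimodularM n (R U : 'M_n) : unimodular R -> unimodular U -> unimodular (R *m U).
Proof.
move=> [uR OR OR'] [uU OU OU'].
by split; rewrite ?unitmx_mul ?uR ?invmx_mul ?mxOverM.
Qed.

Lemma row_span_entry m n (M : 'M[F]_(m, n)) (c : 'rV_m) (a : F) j :
  c \is a mxOver O -> (forall i, M i j / a \in O) -> (c *m M) 0 j / a \in O.
Proof.
move=> /mxOverP cO Ma; rewrite mxE mulr_suml; apply: rpred_sum => i _.
by rewrite -mulrA rpredM.
Qed.

(** Divisibility is total in a valuation ring, so scanning a finite family while keeping the better
    of two entries finds a nonzero one of least valuation. *)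
Lemma max_entry (I : finType) (f : I -> F) i0 : f i0 != 0 ->
  exists i, f i != 0 /\ forall j, f j / f i \in O.
Proof.
move=> f0.
suff [i fi fP] : exists2 i, f i != 0 & forall j, j \in enum I -> f j / f i \in O.
  by exists i; split=> // j; rewrite fP ?mem_enum.
elim: (enum I) => [|k s [i fi fP]]; first by exists i0.
have [fk|fk] := eqVneq (f k) 0.
  exists i => // j; rewrite inE => /orP[/eqP->|/fP//].
  by rewrite fk mul0r rpred0.
have /orP[ki|ki] := O_total (f k / f i).
  by exists i => // j; rewrite inE => /orP[/eqP->|/fP] //.
exists k => // j; rewrite inE => /orP[/eqP->|/fP ji]; first by rewrite divff ?rpred1.
rewrite invf_div in ki.
have -> : f j / f k = (f j / f i) * (f i / f k) by rewrite mulrA divfK.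
exact: rpredM.
Qed.

Lemma row_span_mulr m n (R : 'M_n) (A : 'M[F]_(m, n)) v : R \in unitmx ->
  row_span (A *m R) v <-> row_span A (v *m invmx R).
Proof.
move=> uR; split=> [[a Oa ->]|[a Oa Dv]]; exists a => //; first by rewrite mulmxA mulmxK.
by rewrite mulmxA -Dv mulmxKV.
Qed.


Lemma unimodular_pair n (R U : 'M_n) :
  R *m U = 1%:M -> R \is a mxOver O -> U \is a mxOver O -> unimodular R.
Proof.
move=> RU OR OU; have [uR _] := mulmx1_unit RU.
by split; rewrite ?(invmx_uniq RU).
Qed.

Lemma unimodular_tperm n (i j : 'I_n) : unimodular (tperm_mx i j).
Proof.
have tO : (tperm_mx i j : 'M[F]_n) \is a mxOver O.
  by apply/mxOverP => k l; rewrite !mxE rpred_nat.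
by apply: (unimodular_pair _ tO tO); rewrite -perm_mxM tperm2 perm_mx1.
Qed.

(** On the right, this is the column operation adding multiples of the first column to the
    others. *)
Definition shear n (b : 'rV[F]_n) : 'M_(1 + n) := block_mx 1%:M b 0 1%:M.

Lemma shearN n (b : 'rV_n) : shear b *m shear (- b) = 1%:M.
Proof.
by rewrite mulmx_block !mul1mx !mulmx1 !mul0mx !mulmx0 !addr0 add0r addNr -scalar_mx_block.
Qed.

Lemma mxOver_block m1 m2 n1 n2 (A : 'M_(m1, n1)) (B : 'M_(m1, n2)) (C : 'M_(m2, n1)) (D : 'M_(m2, n2)) :
  A \is a mxOver O -> B \is a mxOver O -> C \is a mxOver O -> D \is a mxOver O ->
  block_mx A B C D \is a mxOver O.
Proof.
move=> OA OB OC OD; apply/mxOverP => i j; rewrite -[i]splitK -[j]splitK.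
case: (fintype.split i) => i'; case: (fintype.split j) => j' /=.
- by rewrite block_mxEul (mxOverP OA).
- by rewrite block_mxEur (mxOverP OB).
- by rewrite block_mxEdl (mxOverP OC).
- by rewrite block_mxEdr (mxOverP OD).
Qed.

Lemma unimodular_shear n (b : 'rV_n) : b \is a mxOver O -> unimodular (shear b).
Proof.
move=> Ob; apply: (unimodular_pair (shearN b));
  by rewrite mxOver_block ?rpredN ?mxOver_scalar ?mxOver0 ?rpred0 ?rpred1.
Qed.

Lemma mul_shear m n (M : 'M_(m, 1 + n)) b :
  M *m shear b = row_mx (lsubmx M) (lsubmx M *m b + rsubmx M).
Proof. by rewrite -{1}[M]hsubmxK mul_row_block !mulmx1 mulmx0 addr0. Qed.

(** Row [i] is [a] times the first unit vector and [a] divides the whole first column. So a multiple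
    of row [i] adjusts the first coordinate of any combination without touching the others, and the
    span splits. *)
Lemma row_span_block m n (M : 'M[F]_(m, 1 + n)) i (N := rsubmx M) (a := M i 0 : F) v :
  a != 0 -> (forall k, M k 0 / a \in O) -> row i N = 0 ->
  row_span M v <-> v 0 0 / a \in O /\ row_span N (rsubmx v).
Proof.
move=> a0 Ma Ni; split=> [[c Oc ->]|[va [c Oc Dv]]].
  split; last by exists c; rewrite // -mulmx_rsub.
  exact: row_span_entry.
pose e : 'rV[F]_m := ((v 0 0 - (c *m M) 0 0) / a) *: delta_mx 0 i.
exists (c + e).
  rewrite rpredD // mxOverZ //; first by rewrite mulrBl rpredB // row_span_entry.
  by apply/mxOverP => k l; rewrite mxE rpred_nat.
rewrite mulmxDl -scalemxAl -rowE -[LHS](@hsubmxK _ _ 1) -[RHS](@hsubmxK _ _ 1).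
congr row_mx.
  apply/matrixP => k l; rewrite !ord1 !mxE -/a.
  have -> : lshift n 0 = 0 :> 'I_(1 + n) by apply: val_inj.
  by rewrite -[M i 0]/a divfK // addrCA subrr addr0.
apply/rowP => k; have /rowP/(_ k) := Ni; have /rowP/(_ k) := Dv; rewrite !mxE => -> ->.
rewrite mulr0 addr0; apply: eq_bigr => l _; by rewrite !mxE.
Qed.

(* Elementary divisors; working with row spans, only column operations are needed. *)
Lemma row_span_diag m n (M : 'M[F]_(m, n)) : exists (R : 'M_n) (f : 'rV_n),
  unimodular R /\ forall v, row_span M v <-> row_span (diag_mx f *m R) v.
Proof.
elim: n M => [|n IHn] M.
  exists 1%:M, 0; split; first exact: unimodular1.
  by move=> v; split=> _; exists 0; rewrite ?mxOver0 ?rpred0 //; apply/rowP => -[].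
have [->|/matrix0Pn[i0 [j0 nz0]]] := eqVneq M 0.
  exists 1%:M, 0; split=> [|v]; first exact: unimodular1.
  rewrite linear0 mul0mx.
  by split=> -[a Oa ->]; exists 0; rewrite ?mulmx0 ?mxOver0 ?rpred0.
(* The pivot divides every entry: integral column operations clear its row, and its column need not
   be cleared, by [row_span_block]. *)
have [[i j] /= [nzij Mij]] := @max_entry _ (fun k => M k.1 k.2) (i0, j0) nz0.
have {i0 j0 nz0} Mij k l : M k l / M i j \in O := Mij (k, l).
wlog j0 : M j nzij Mij / j = 0.
  move=> IH; have [|k l|R [f [uR RP]]] := IH (xcol j 0 M) 0 _ _ erefl; rewrite ?mxE ?tpermR //.
  have ut := unimodular_tperm j 0; have [ut1 _ _] := ut.
  exists (R *m tperm_mx j 0), f; split=> [|v]; first exact: unimodularM.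
  have {1}-> : M = xcol j 0 M *m tperm_mx j 0.
    by rewrite xcolE -mulmxA -perm_mxM tperm2 perm_mx1 mulmx1.
  by have RPv := RP (v *m invmx (tperm_mx j 0)); rewrite mulmxA; split=> /row_span_mulr-/(_ ut1)/RPv ?; apply/row_span_mulr.
subst j; set a := M i 0 in nzij Mij.
pose b : 'rV[F]_n := \row_k (M i (rshift 1 k) / a).
have Ob : b \is a mxOver O by apply/mxOverP => k l; rewrite mxE.
have Us := unimodular_shear Ob; have [us _ _] := Us.
pose M' : 'M_(m, 1 + n) := M *m invmx (shear b).
have DM : M = M' *m shear b by rewrite mulmxKV.
have M'E : M' = M *m shear (- b).
  by rewrite /M' (invmx_uniq (shearN b)).
rewrite mul_shear in M'E.
have l0 : 0 = lshift n 0 :> 'I_(1 + n) by apply: val_inj.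
have M'0 k : M' k 0 = M k 0 by rewrite M'E l0 row_mxEl mxE.
have M'i : row i (rsubmx M') = 0.
  rewrite M'E row_mxKr; apply/rowP => k; rewrite !mxE big_ord1 !mxE -l0.
  by rewrite -/a mulrN mulrCA divff // mulr1 addNr.
have [R [f [UR RP]]] := IHn (rsubmx M').
have UR1 : unimodular (block_mx 1%:M 0 0 R : 'M_(1 + n)).
  have [uR OR OR'] := UR.
  apply: (@unimodular_pair _ _ (block_mx 1%:M 0 0 (invmx R)));
    rewrite ?mxOver_block ?mxOver_scalar ?mxOver0 ?rpred0 ?rpred1 //.
  by rewrite mulmx_block !mul1mx !mulmx1 !mul0mx !mulmx0 !addr0 !add0r mulmxV // -scalar_mx_block.
exists (block_mx 1%:M 0 0 R *m shear b), (row_mx a%:M f); split.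
  exact: unimodularM.
move=> v; rewrite {1}DM mulmxA (@row_span_mulr _ _ _ _ _ us) (@row_span_mulr _ _ _ _ _ us).
rewrite (@row_span_block _ _ M' i) ?M'0 // -/a; last by move=> k; rewrite M'0.
rewrite {}RP; set u := v *m _.
have E : diag_mx (row_mx a%:M f) *m block_mx 1%:M 0 0 R =
          block_mx a%:M 0 0 (diag_mx f *m R) :> 'M_(1 + n).
  rewrite diag_mx_row mulmx_block !mulmx1 !mul0mx !mulmx0 !addr0 !add0r; congr block_mx.
  by apply/matrixP => k l; rewrite !ord1 !mxE.
rewrite [X in row_span X u]E; set X := diag_mx f *m R.
have a00 : (block_mx a%:M 0 0 X : 'M_(1 + n)) 0 0 = a by rewrite l0 block_mxEul mxE.
apply: (iff_trans _ (iff_sym (@row_span_block _ _ (block_mx a%:M 0 0 X : 'M_(1 + n)) 0 u _ _ _))).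
- rewrite a00 block_mxEh row_mxKr.
  split=> -[? [c Oc Dc]]; split=> //.
    exists (row_mx 0 c); last by rewrite mul_row_col mul0mx add0r.
    apply/mxOverP => k l; rewrite -[l]splitK; case: (fintype.split l) => l' /=.
      by rewrite row_mxEl mxE rpred0.
    by rewrite row_mxEr (mxOverP Oc).
  exists (rsubmx c); first by apply/mxOverP => k l; rewrite mxE (mxOverP Oc).
  by rewrite Dc -{1}[c]hsubmxK mul_row_col mulmx0 add0r.
- by rewrite a00.
- move=> k; rewrite a00 -[k]splitK; case: (fintype.split k) => k' /=.
    by rewrite ord1 -l0 a00 divff ?rpred1.
  by rewrite l0 block_mxEdl mxE mul0r rpred0.
- by rewrite block_mxEh row_mxKr l0 rowKu row0.
Qed.

(** If an elementary divisor were zero, the corresponding coordinate in the basis [R] would vanish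
    on all rows of [M], against full rank. *)
Lemma row_span_full_diag m n (M : 'M[F]_(m, n)) : row_full M -> exists (R : 'M_n) (f : 'I_n -> F),
  [/\ unimodular R, forall i, f i != 0 &
    forall v, row_span M v <-> forall i, (v *m invmx R) 0 i / f i \in O].
Proof.
move=> fullM; have [R [f [[uR OR OR'] RP]]] := row_span_diag M.
have RP' v : row_span M v <-> row_span (diag_mx f) (v *m invmx R).
  by rewrite RP row_span_mulr.
have f0 i : f 0 i != 0.
  apply/eqP => fi0.
  suff Mi0 : M *m invmx R *m delta_mx i (0 : 'I_1) = 0.
    have /row_fullP[N NM] := fullM.
    have : R *m (N *m (M *m invmx R *m delta_mx i (0 : 'I_1))) = 0 by rewrite Mi0 !mulmx0.
    rewrite !mulmxA -(mulmxA R N M) NM mulmx1 mulmxV // mul1mx => /matrixP/(_ i 0)/eqP.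
    by rewrite !mxE !eqxx oner_eq0.
  apply/row_matrixP => k; rewrite row_mul row0 row_mul.
  have [|a Oa ->] := (RP' (row k M)).1.
    exists (delta_mx 0 k); last exact: rowE.
    by apply/mxOverP => ? ?; rewrite mxE rpred_nat.
  apply/matrixP => x y; rewrite !ord1 -mulmxA mul_diag_mx mxE big1 ?mxE // => l _.
  rewrite !mxE; have [->|_] := eqVneq l i; first by rewrite fi0 !(mul0r, mulr0).
  by rewrite !mulr0.
exists R, (fun i => f 0 i); split=> //; move=> v; rewrite RP'; set u := v *m _.
split=> [[a /mxOverP Oa ->] i|Ou].
  by rewrite mul_mx_diag mxE mulfK.
exists (\row_i (u 0 i / f 0 i)); first by apply/mxOverP => k l; rewrite mxE.
by apply/rowP => i; rewrite mul_mx_diag !mxE divfK.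
Qed.

Lemma row_span_invertible m n (M : 'M[F]_(m, n)) : row_full M -> exists2 P : 'M_n,
  P \in unitmx & forall v, row_span M v <-> v *m invmx P \is a mxOver O.
Proof.
move=> /row_span_full_diag[R [f [[uR _ _] f0 RP]]].
pose D := diag_mx (\row_i f i); pose D' := diag_mx (\row_i (f i)^-1).
have DD' : D *m D' = 1%:M.
  by rewrite mulmx_diag; apply/matrixP => i j; rewrite !mxE divff.
have [uD _] := mulmx1_unit DD'.
exists (D *m R) => [|v]; first by rewrite unitmx_mul uD.
rewrite RP invmx_mul // (invmx_uniq DD') mulmxA mul_mx_diag.
split=> [Ov|/mxOverP Ov i]; last by have := Ov 0 i; rewrite !mxE.
by apply/mxOverP => k i; rewrite !mxE ord1; have := Ov i; rewrite mxE.
Qed.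

(** The second lattice is diagonalized in coordinates of a basis [P] of the first; as [R] is in
    GL_n(O), [R *m P] is still a basis of the first. *)
Lemma lattice_adapted_basis m1 m2 n (B1 : 'M[F]_(m1, n)) (B2 : 'M[F]_(m2, n)) :
  row_full B1 -> row_full B2 -> exists (P : 'M_n) (f : 'I_n -> F),
  [/\ P \in unitmx, forall i, f i != 0,
      forall v, row_span B1 v <-> v *m invmx P \is a mxOver O
    & forall v, row_span B2 v <-> forall i, (v *m invmx P) 0 i / f i \in O].
Proof.
move=> /row_span_invertible[P uP B1P] full2.
have [|R [f [[uR OR OR'] f0 RP]]] := @row_span_full_diag _ _ (B2 *m invmx P).
  have /row_fullP[N NB] := full2; apply/row_fullP; exists (P *m N).
  by rewrite mulmxA -(mulmxA P) NB mulmx1 mulmxV.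
exists (R *m P), f; rewrite invmx_mul //; split=> // [|v|v]; first by rewrite unitmx_mul uR.
  rewrite B1P mulmxA; split=> Ov; first exact: mxOverM.
  by rewrite -(mulmxKV uR (v *m _)) mxOverM.
by rewrite mulmxA -RP -row_span_mulr // mulmxKV.
Qed.
End ValuationRing.

(** * Lifting idempotents in a complete ring *)

(** Newton's step for [z * z - z], with the inverse of the derivative [2z - 1] replaced by [2z - 1]
    itself, which is its own inverse modulo [z * z - z]. The error gets squared. *)
Lemma newton_identity (R : comRingType) (z : R) :
  (z + (1 - z *+ 2) * (z * z - z)) * (z + (1 - z *+ 2) * (z * z - z))
    - (z + (1 - z *+ 2) * (z * z - z))
  = (z * z - z) * (z * z - z) * ((z * z - z) *+ 4 - 1 *+ 3).
Proof. by ring. Qed.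

Section CompleteRing.
Variables (F : fieldType) (O : subringClosed F) (w : F).
Hypothesis w_in : w \in O.
Hypothesis wV_notin : w^-1 \notin O.
Hypothesis w_unif : forall x, x \in O -> x^-1 \notin O -> x / w \in O.
Hypothesis w_sep : forall x, (forall n, x / w ^+ n \in O) -> x = 0.
Hypothesis w_complete : forall u : nat -> F,
  (forall n, (u n.+1 - u n) / w ^+ n \in O) -> exists l, forall n, (u n - l) / w ^+ n \in O.

Definition adic n a b (M : 'M_(a, b)) := forall i j, M i j / w ^+ n \in O.

Let w_neq0 : w != 0.
Proof. by apply: contraNneq wV_notin => ->; rewrite invr0 rpred0. Qed.

Lemma adicD n a b (M N : 'M_(a, b)) : adic n M -> adic n N -> adic n (M + N).
Proof. by move=> HM HN i j; rewrite mxE mulrDl rpredD. Qed.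

Lemma adicN n a b (M : 'M_(a, b)) : adic n M -> adic n (- M).
Proof. by move=> HM i j; rewrite mxE mulNr rpredN. Qed.

Lemma adicB n a b (M N : 'M_(a, b)) : adic n M -> adic n N -> adic n (M - N).
Proof. by move=> HM /adicN; apply: adicD. Qed.

Lemma adicM n m a b c (M : 'M_(a, b)) (N : 'M_(b, c)) :
  adic n M -> adic m N -> adic (n + m) (M *m N).
Proof.
move=> HM HN i j; rewrite mxE mulr_suml rpred_sum // => k _.
by rewrite exprD invfM mulrACA rpredM.
Qed.

Lemma adic_sum n a b I (r : seq I) (P : pred I) (f : I -> 'M_(a, b)) :
  (forall i, P i -> adic n (f i)) -> adic n (\sum_(i <- r | P i) f i).
Proof.
move=> H; elim/big_rec: _ => [i j|k M Pk HM]; first by rewrite mxE mul0r rpred0.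
exact/adicD/HM/H.
Qed.

Lemma adicZ n a b c (M : 'M_(a, b)) : c \in O -> adic n M -> adic n (c *: M).
Proof. by move=> Oc HM i j; rewrite mxE -mulrA rpredM. Qed.

Lemma adicMn n a b k (M : 'M_(a, b)) : adic n M -> adic n (M *+ k).
Proof. by move=> HM; rewrite -scaler_nat; apply/adicZ/HM/rpred_nat. Qed.

Lemma adic_le n m a b (M : 'M_(a, b)) : (n <= m)%N -> adic m M -> adic n M.
Proof.
move=> nm HM i j.
have -> : M i j / w ^+ n = M i j / w ^+ m * w ^+ (m - n).
  rewrite -{1}(subnK nm) exprD invfM mulrA mulrAC divfK ?expf_neq0 //.
by rewrite rpredM ?rpredX.
Qed.

Lemma adic_sep a b (M : 'M_(a, b)) : (forall n, adic n M) -> M = 0.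
Proof. by move=> HM; apply/matrixP => i j; rewrite mxE; apply: w_sep => n; apply: HM. Qed.

Lemma adic_complete a b (u : nat -> 'M_(a, b)) :
  (forall n, adic n (u n.+1 - u n)) -> exists l, forall n, adic n (u n - l).
Proof.
move=> Hu.
have L i j : exists l, forall n, (u n i j - l) / w ^+ n \in O.
  by apply: w_complete => n; have := Hu n i j; rewrite !mxE.
exists (\matrix_(i, j) sval (cid (L i j))) => n i j.
by rewrite !mxE; apply: (svalP (cid (L i j))).
Qed.

Section Newton.
Variables (d : nat) (e : 'M[F]_d.+1).
Hypotheses (e_in : adic 0 e) (e_idem : adic 1 (e * e - e)).

Fixpoint newton n : 'M_d.+1 :=
  if n is m.+1 then let x := newton m in x + (1 - x *+ 2) * (x * x - x) else e.

Lemma adic1 : adic 0 (1 : 'M_d.+1).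
Proof. by move=> i j; rewrite expr0 divr1 !mxE rpred_nat. Qed.

(** The matrix ring is not commutative, so the identity is taken for a polynomial variable and
    evaluated at [x]. *)
Lemma newton_step_idem (x : 'M[F]_d.+1) (q := x * x - x) (y := x + (1 - x *+ 2) * q) :
  y * y - y = q * q * (q *+ 4 - 1 *+ 3).
Proof.
have := congr1 (horner_mx x) (newton_identity ('X : {poly F})).
by rewrite !(rmorphB, rmorphD, rmorphM, rmorphMn, rmorph1) /= !horner_mx_X; apply.
Qed.

Lemma newtonP n : adic 0 (newton n) /\ adic n.+1 (newton n * newton n - newton n).
Proof.
elim: n => [|n [IH0 IH]] //=; set x := newton n in IH0 IH *; set q := x * x - x in IH *.
have H0 : adic 0 q by apply: adic_le IH.
split.
  apply: adicD => //; apply: (@adicM 0 0) => //.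
  by apply: adicB; [apply: adic1 | apply: adicMn].
rewrite newton_step_idem -/q.
have Hq : adic n.+2 (q * q) by apply: (@adic_le _ (n.+1 + n.+1)); [rewrite addSn ltnS leq_addl | apply: adicM].
rewrite -[n.+2]addn0; apply: adicM => //.
by apply: adicB; apply: adicMn => //; apply: adic1.
Qed.

(** Every iterate is a polynomial in [e], so it commutes with whatever commutes with [e].
    Idempotence and commutation pass to the limit because only zero is divisible by all powers of
    [w]. *)
Lemma newton_lift : exists f : 'M_d.+1, [/\ f * f = f, adic 1 (e - f) &
  forall g, adic 0 g -> e * g = g * e -> f * g = g * f].
Proof.
have step n : adic n.+1 (newton n.+1 - newton n).
  have [H0 H] := newtonP n; rewrite /= addrAC subrr add0r -[n.+1]add0n.
  by apply: adicM => //; apply: adicB; [apply: adic1 | apply: adicMn].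
have [n|f fP] := @adic_complete _ _ newton; first exact: adic_le (step n).
have f0 : adic 0 f.
  by rewrite -[f](subKr (newton 0)); apply: adicB; [apply: (newtonP 0).1 | apply: fP].
exists f; split.
- apply/eqP; rewrite -subr_eq0; apply/eqP/adic_sep => n.
  have [H0 /(adic_le (leqnSn n)) H] := newtonP n; set x := newton n in H0 H *.
  have -> : f * f - f = (x * x - x) - ((x - f) * x + f * (x - f) - (x - f)).
    rewrite mulrBl mulrBr addrA subrK; symmetry.
    by rewrite [- (_ - (x - f))]opprB !addrA subrK opprB addrC addrA subrK.
  apply: adicB => //; apply: adicB; last exact: fP.
  by apply: adicD; [rewrite -[n]addn0 | rewrite -[n]add0n]; apply: adicM; rewrite ?addn0.
- have -> : e - f = (newton 1 - f) - (newton 1 - e) by rewrite opprB [RHS]addrC addrA subrK.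
  by apply: adicB; [apply: fP | apply: (step 0)].
move=> g g0 eg; have xg n : newton n * g = g * newton n.
  elim: n => //= n IHn; set x := newton n in IHn *.
  have c : GRing.comm g x by [].
  by symmetry; apply: commrD => //; apply: commrM; do ?[apply: commrB | apply: commrMn | apply: commrM | apply: commr1].
apply/eqP; rewrite -subr_eq0; apply/eqP/adic_sep => n.
have -> : f * g - g * f = g * (newton n - f) - (newton n - f) * g.
  by rewrite mulrBl mulrBr xg opprB [RHS]addrC addrA subrK.
by apply: adicB; [rewrite -[n]add0n | rewrite -[n]addn0]; apply: adicM; rewrite ?addn0.
Qed.
End Newton.

(** * Averaging over the group, and Schur's lemma *)

Section AdaptedBasis.
Variables (gT : finGroupType) (G : {group gT}) (d : nat) (r : gT -> 'M[F]_d.+1).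
Hypothesis cardG : (#|G|%:R)^-1 \in O.
Hypothesis cardG0 : #|G|%:R != 0 :> F.
Hypothesis r1 : r 1%g = 1.
Hypothesis rM : forall g h, g \in G -> h \in G -> r (g * h)%g = r g * r h.
Variable f : 'I_d.+1 -> F.
Hypothesis f0 : forall i, f i != 0.
Hypothesis r_in : forall g i j, g \in G -> r g i j \in O.
Hypothesis r_in_f : forall g i j, g \in G -> f i * r g i j / f j \in O.

Let r_adic g : g \in G -> adic 0 (r g).
Proof. by move=> gG i j; rewrite expr0 divr1 r_in. Qed.

Variable i0 : 'I_d.+1.
Hypothesis min0 : forall j, f j / f i0 \in O.

(** As [f i0] divides every [f j], [m j] says that [f j] has minimal valuation too; [E] is the
    projection onto these coordinates. *)
Let m j := f i0 / f j \in O.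
Let E : 'M[F]_d.+1 := diag_mx (\row_j (m j)%:R).

Let E_adic : adic 0 E.
Proof. by move=> i j; rewrite expr0 divr1 !mxE rpredMn // rpred_nat. Qed.

(** For [i] minimal and [j] not, [f j / f i] is a non-unit of [O], hence a multiple of [w], and it
    divides [r g i j]. *)
Let E_r g : g \in G -> adic 1 (E * r g * E - E * r g).
Proof.
move=> gG i j; have := r_in_f i j gG; have := r_in i j gG; move: (r g) => R RO Rf.
rewrite -!mulmxE mul_mx_diag mul_diag_mx !mxE expr1.
have [mj|mj] := boolP (m j); first by rewrite mulr1 subrr mul0r rpred0.
rewrite mulr0 sub0r mulNr rpredN; have [mi|_] := boolP (m i); last by rewrite !mul0r rpred0.
rewrite mul1r (_ : R i j / w = (f i * R i j / f j) * (f j / f i / w)); last first.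
  by field; rewrite !f0 w_neq0.
rewrite rpredM //; apply: w_unif.
  have -> : f j / f i = (f j / f i0) * (f i0 / f i) by field; rewrite !f0.
  by rewrite rpredM.
apply: contra mj; rewrite /m invf_div => ij.
have -> : f i0 / f j = (f i0 / f i) * (f i / f j) by field; rewrite !f0.
by rewrite rpredM.
Qed.

Let E' : 'M_d.+1 := (#|G|%:R)^-1 *: \sum_(g in G) r g^-1%g * E * r g.

Let E'_adic : adic 0 E'.
Proof.
apply: adicZ => //; apply: adic_sum => g gG.
by apply: (@adicM 0 0); [apply: (@adicM 0 0) |]; rewrite ?r_adic ?groupV //; apply: r_adic; rewrite ?groupV.
Qed.

Let avgZ (A : 'M[F]_d.+1) : (#|G|%:R : F)^-1 *: \sum_(g in G) A = A.
Proof. by rewrite sumr_const -scaler_nat scalerA mulVf // scale1r. Qed.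

(** Modulo [w], [E_r] erases the second [E] in [E * r g^-1 * E * r g], and the rest collapses to
    [E]. *)
Let EE' : adic 1 (E * E' - E).
Proof.
rewrite -[X in _ - X]avgZ -scalerAr -scalerBr mulr_sumr -sumrB; apply: adicZ => //.
apply: adic_sum => g gG; have gG' : g^-1%g \in G by rewrite groupV.
have -> : E * (r g^-1%g * E * r g) - E = (E * r g^-1%g * E - E * r g^-1%g) * r g.
  by rewrite mulrBl !mulrA -[X in _ = _ - X]mulrA -rM // mulVg r1 mulr1.
by apply: (@adicM 1 0); [apply: E_r | apply: r_adic].
Qed.

Let E'E : adic 1 (E' * E - E').
Proof.
rewrite -scalerAl -scalerBr mulr_suml -sumrB; apply: adicZ => //.
apply: adic_sum => g gG; have gG' : g^-1%g \in G by rewrite groupV.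
have -> : r g^-1%g * E * r g * E - r g^-1%g * E * r g = r g^-1%g * (E * r g * E - E * r g).
  by rewrite mulrBr !mulrA.
by apply: (@adicM 0 1); [apply: r_adic | apply: E_r].
Qed.

(** Modulo [w], [E' E' = (E' E) E' = E' (E E') = E' E = E']. *)
Let E'_idem : adic 1 (E' * E' - E').
Proof.
have -> : E' * E' - E' = (E' * E - E') + E' * (E * E' - E) - (E' * E - E') * E'.
  rewrite mulrBr mulrBl !mulrA [E' * E - E' + _]addrC.
  by rewrite (addrA (_ - _) (E' * E)) subrK opprB [RHS]addrC addrA subrK.
by apply: adicB; [apply: adicD => //; apply: (@adicM 0 1) | apply: (@adicM 1 0)].
Qed.

Let E'_comm h : h \in G -> E' * r h = r h * E'.
Proof.
move=> hG; rewrite -scalerAl -scalerAr mulr_suml mulr_sumr; congr (_ *: _).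
rewrite [RHS](reindex_inj (mulIg h)) /=; apply: eq_big => [g|g gG]; first by rewrite groupMr.
rewrite invMg !rM ?groupV // !mulrA -rM ?groupV // mulgV r1 mul1r //.
Qed.

Lemma averaged_idempotent : exists e : 'M_d.+1,
  [/\ e * e = e, forall g, g \in G -> e * r g = r g * e,
      adic 1 (E * e - E) & adic 1 (e * E - e)].
Proof.
have [e [ee eE eC]] := newton_lift E'_adic E'_idem.
exists e; split=> // [g gG||]; first by apply: eC; [apply: r_adic | apply: E'_comm].
  have -> : E * e - E = (E * E' - E) - E * (E' - e) by rewrite mulrBr opprB [RHS]addrC addrA subrK.
  by apply: adicB => //; apply: (@adicM 0 1).
have -> : e * E - e = (E' * E - E') - (E' - e) * E + (E' - e).
by rewrite mulrBl opprB [E' * E - E' + _]addrC (addrA (_ - _) (E' * E)) subrK addrA subrK.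
by apply: adicD => //; apply: adicB => //; apply: (@adicM 1 0).
Qed.
End AdaptedBasis.

(* Modulo w the coordinates of minimal valuation would span a G-stable subspace; since *)
(* #|G| is invertible it is cut out by an equivariant idempotent, which lifts.         *)
Lemma adapted_basis_equal (gT : finGroupType) (G : {group gT}) d
    (rG : mx_representation F G d.+1) (P : 'M[F]_d.+1) (f : 'I_d.+1 -> F) (i0 : 'I_d.+1) :
  mx_irreducible rG -> (#|G|%:R)^-1 \in O -> #|G|%:R != 0 :> F ->
  P \in unitmx -> (forall i, f i != 0) ->
  (forall g i j, g \in G -> (P *m rG g *m invmx P) i j \in O) ->
  (forall g i j, g \in G -> f i * (P *m rG g *m invmx P) i j / f j \in O) ->
  (forall j, f j / f i0 \in O) -> forall j, f i0 / f j \in O.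
Proof.
move=> irrG cardG cardG0 uP f0; pose r g := P *m rG g *m invmx P.
rewrite -/(r _) => r_in r_in_f min0 j.
have r1 : r 1%g = 1 by rewrite /r repr_mx1 mulmx1 mulmxV.
have rM g h : g \in G -> h \in G -> r (g * h)%g = r g * r h.
  by move=> gG hG; rewrite /r repr_mxM // -mulmxE !mulmxA mulmxKV.
have [e [ee eC]] := averaged_idempotent cardG cardG0 r1 rM f0 r_in r_in_f min0.
set E := diag_mx _ => Ee eE.
pose c := invmx P *m e *m P.
have cc : c *m c = c.
  by rewrite /c !mulmxA mulmxK // -(mulmxA _ e e) mulmxE ee.
have cG : centgmx rG c.
  apply/centgmxP => g gG; rewrite /c.
  have := congr1 (fun A => invmx P *m A *m P) (eC g gG).
  by rewrite /r -!mulmxE !mulmxA !mulmxKV // mulVmx // mul1mx.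
have Dc : e = P *m c *m invmx P by rewrite /c !mulmxA mulmxV // mul1mx mulmxK.
(* If [c = 0] then [E] vanishes modulo [w], although its entry at [i0] is 1. *)
have [c0|nzc] := eqVneq c 0.
  move: (Ee i0 i0); rewrite Dc c0 mulmx0 mul0mx mulr0 sub0r !mxE eqxx divff // rpred1.
  by rewrite mulNr rpredN mul1r expr1 (negPf wV_notin).
have uc := mx_Schur irrG cG nzc.
have c1 : c = 1%:M by apply: (can_inj (mulKmx uc)); rewrite mulmx1.
have e1 : e = 1 by rewrite Dc c1 mulmx1 mulmxV.
(* Now [E] is the identity modulo [w], so its diagonal entry at [j] cannot be 0. *)
move: (eE j j); rewrite e1 mul1r !mxE eqxx expr1.
have [//|_] := boolP (f i0 / f j \in O).
by rewrite mul0rn sub0r mulNr rpredN mul1r (negPf wV_notin).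
Qed.
End CompleteRing.

(** * The absolute value of Q_p *)

Section Padic.
Variables (p : nat) (Q : padic_field p).
Hypothesis p_prime : prime p.
Local Notation abs := (@qp_abs p Q).

Let p_gt0 : 0 < p%:R :> rat.
Proof. by rewrite ltr0n prime_gt0. Qed.
Let p_gt1 : 1 < p%:R :> rat.
Proof. by rewrite ltr1n prime_gt1. Qed.

Lemma qp_abs0 : abs 0 = 0.
Proof.
have := qp_abs_rat Q 0; rewrite /padic_abs eqxx => <-; congr qp_abs.
by rewrite /ratr mul0r.
Qed.

Lemma qp_abs1 : abs 1 = 1.
Proof.
have nz : abs 1 != 0 by apply/eqP => /qp_abs_eq0/eqP; rewrite oner_eq0.
by apply: (mulfI nz); rewrite -qp_absM !mulr1.
Qed.

Lemma qp_absN x : abs (- x) = abs x.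
Proof.
rewrite -mulN1r qp_absM; suff -> : abs (-1) = 1 by rewrite mul1r.
have /eqP : abs (-1) ^+ 2 = 1 by rewrite expr2 -qp_absM mulrNN mulr1 qp_abs1.
by rewrite sqrf_eq1 => /orP[/eqP//|/eqP E]; have := qp_abs_ge0 (-1 : Q); rewrite E.
Qed.

Lemma qp_absX x n : abs (x ^+ n) = abs x ^+ n.
Proof. by elim: n => [|n IHn]; rewrite ?expr0 ?qp_abs1 // !exprS qp_absM IHn. Qed.

Lemma qp_abs_neq0 x : x != 0 -> abs x != 0.
Proof. by apply: contra => /eqP/qp_abs_eq0 ->. Qed.

Lemma qp_absV x : abs x^-1 = (abs x)^-1.
Proof.
have [->|x0] := eqVneq x 0; first by rewrite invr0 qp_abs0 invr0.
by apply: (mulfI (qp_abs_neq0 x0)); rewrite -qp_absM !divff ?qp_abs1 ?qp_abs_neq0.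
Qed.

Lemma qp_abs_sum I (r : seq I) (P : pred I) (f : I -> Q) B : 0 <= B ->
  (forall i, P i -> abs (f i) <= B) -> abs (\sum_(i <- r | P i) f i) <= B.
Proof.
move=> B0 fB; elim/big_rec: _ => [|i x Pi xB]; first by rewrite qp_abs0.
by apply: le_trans (qp_absD _ _) _; rewrite ge_max fB.
Qed.

Lemma ratr_nat_field (F : fieldType) n : ratr n%:R = n%:R :> F.
Proof.
by rewrite /ratr pmulrn numq_int denq_int mulr1z divr1 -pmulrn.
Qed.

Lemma qp_abs_nat n : (0 < n)%N -> abs n%:R = (p%:R ^+ logn p n)^-1.
Proof.
move=> n0; rewrite -ratr_nat_field qp_abs_rat /padic_abs pnatr_eq0 eqn0Ngt n0 /=.
rewrite /padic_val (pmulrn 1 n) numq_int denq_int logn1 subr0. 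
by rewrite -exprnN absz_nat.
Qed.

Lemma qp_abs_p : abs p%:R = p%:R^-1.
Proof. by rewrite qp_abs_nat ?prime_gt0 // (logn_prime _ p_prime) eqxx expr1. Qed.

(** A rational closer to [x] than [abs x] has the same absolute value, which is an integral power of
    [p]. *)
Lemma qp_abs_lt1 x : abs x < 1 -> abs x <= p%:R^-1.
Proof.
have [->|x0] := eqVneq x 0; first by rewrite qp_abs0 invr_ge0 ltW.
have ax : 0 < abs x by rewrite lt_def qp_abs_neq0 ?qp_abs_ge0.
have [a xa] := qp_dense x ax.
have Dx : abs x = padic_abs p a.
  rewrite -(qp_abs_rat Q); apply/eqP; rewrite eq_le; apply/andP; split.
    have := qp_absD (x - ratr a) (ratr a); rewrite subrK le_max => /orP[|//].
    by rewrite leNgt xa.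
  have := qp_absD (ratr a - x) x; rewrite subrK => /le_trans; apply.
  by rewrite ge_max lexx -opprB qp_absN ltW.
rewrite Dx in ax *; move: ax; rewrite /padic_abs; case: eqP => // _ _.
case: (padic_val p a) => [[|n]|n].
- by rewrite oppr0 expr0z ltxx.
- move=> _; rewrite -exprnN lef_pV2 ?posrE ?exprn_gt0 // exprS ler_peMr ?exprn_ege1 ?ltW //.
by rewrite NegzE opprK -exprnP => /(le_lt_trans (exprn_ege1 _ (ltW p_gt1))); rewrite ltxx.
Qed.

Lemma qp_lim (v : nat -> Q) : (forall n, abs (v n.+1 - v n) <= p%:R ^- n) ->
  exists l, forall n, abs (v n - l) <= p%:R ^- n.
Proof.
move=> Hv.
have Hle n m : (n <= m)%N -> abs (v m - v n) <= p%:R ^- n.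
  move=> /subnK <-; elim: (m - n)%N => [|k IHk]; first by rewrite subrr qp_abs0 invr_ge0 exprn_ge0 ?ltW.
  rewrite addSn -[v _ - _](subrKA (v (k + n)%N)); apply: le_trans (qp_absD _ _) _.
  rewrite ge_max IHk andbT; apply: le_trans (Hv _) _.
  by rewrite lef_pV2 ?posrE ?exprn_gt0 // ler_eXn2l ?leq_addl.
have small (e : rat) : 0 < e -> exists N, p%:R ^- N < e.
  move=> e0; exists (Num.bound e^-1); rewrite invf_plt ?posrE ?exprn_gt0 //.
  apply: lt_trans (archi_boundP _) _; first by rewrite invr_ge0 ltW.
  by rewrite -natrX ltr_nat ltn_expl ?prime_gt1.
have [|l Hl] := @qp_complete p Q v.
  move=> e /small[N Ne]; exists N => m n Nm Nn; apply: le_lt_trans Ne.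
  rewrite -[v m - v n](subrKA (v N)); apply: le_trans (qp_absD _ _) _.
  by rewrite ge_max Hle // -opprB qp_absN Hle.
exists l => n; have [|N HN] := Hl (p%:R ^- n); first by rewrite invr_gt0 exprn_gt0.
rewrite -[v n - l](subrKA (v (maxn n N))); apply: le_trans (qp_absD _ _) _.
by rewrite ge_max -opprB qp_absN Hle ?leq_maxl // ltW // HN // leq_maxr.
Qed.

Lemma qp_p_neq0 : p%:R != 0 :> Q.
Proof.
apply/eqP => p0; have := qp_abs_p; rewrite p0 qp_abs0 => /eqP.
by rewrite eq_sym invr_eq0 gt_eqF.
Qed.

(** * The integral closure of Z_p in a finite extension, and its p-adic completeness *)

Section Extension.
Variable F : fieldExtType Q.
Local Notation O := (intcl (in_alg F)).

Lemma intcl_scale a x : abs a <= 1 -> x \in O -> a *: x \in O.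
Proof.
move=> a1 Ox; rewrite -[x]mul1r scalerAl rpredM //; apply/asboolP.
exact: (@integral_id _ _ (padic_int_to (in_alg F)) (Sub a a1 : padic_int Q)).
Qed.

(** Z_p is integrally closed: if [abs a > 1], the leading term of a monic integral equation for [a]
    dominates all the others. *)
Lemma intcl_alg a : (a%:A \in O) = (abs a <= 1).
Proof.
apply/idP/idP => [/asboolP[P monP]|a1]; last by rewrite intcl_scale ?rpred1.
pose f : {rmorphism padic_int Q -> Q} := (val : padic_int Q -> Q).
pose R := map_poly f P.
rewrite /root (_ : map_poly _ P = map_poly (in_alg F) R); last by rewrite -map_poly_comp.
rewrite -[a%:A]/(in_alg F a) horner_map fmorph_eq0 /=. have monR : R \is monic by rewrite /R monic_map.
have R1 i : abs R`_i <= 1 by rewrite coef_map; case: P`_i.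
rewrite leNgt; apply: contraTN => a1.
have := monR; rewrite monicE lead_coefE; case Ds: (size R) => [|n] /eqP.
  by move/eqP: Ds; rewrite size_poly_eq0 => /eqP->; rewrite coef0 => /eqP; rewrite eq_sym oner_eq0.
move=> /= Rn; rewrite horner_coef Ds big_ord_recr /= Rn mul1r addrC addr_eq0.
apply/negP => /eqP E; have := congr1 abs E; rewrite qp_absN qp_absX => E'.
have a0 : 0 < abs a by apply: lt_trans a1.
case: n => [|n] in E' Rn Ds E *.
  by move: E'; rewrite big_ord0 qp_abs0 expr0 => /eqP; rewrite oner_eq0.
have : abs a ^+ n.+1 <= abs a ^+ n.
  rewrite E'; apply: qp_abs_sum; first exact/exprn_ge0/ltW.
  move=> i _; rewrite qp_absM qp_absX; apply: le_trans (ler_piMl _ (R1 i)) _.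
    exact/exprn_ge0/ltW.
  by rewrite ler_eXn2l // -ltnS ltn_ord.
by rewrite ler_eXn2l // ltnn.
Qed.

Lemma intcl_pV : p%:R^-1 \notin O.
Proof.
rewrite (_ : p%:R^-1 = (p%:R^-1)%:A); last by rewrite -in_algE fmorphV rmorph_nat.
by rewrite intcl_alg qp_absV qp_abs_p invrK -ltNge.
Qed.

Let pF_neq0 : p%:R != 0 :> F.
Proof. by rewrite -(rmorph_nat (in_alg F)) fmorph_eq0 qp_p_neq0. Qed.

Lemma scale_natr n (a : Q) (x : F) : (a * n%:R) *: x = (a *: x) * n%:R.
Proof. by rewrite mulr_natr mulr_natr -scalerMnl. Qed.

Lemma qp_abs_divp a : abs a < 1 -> abs (a / p%:R) <= 1.
Proof.
move=> /qp_abs_lt1 a1; rewrite qp_absM qp_absV qp_abs_p invrK.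
by rewrite -ler_pdivlMr // mul1r.
Qed.

Lemma intcl_divp a x : abs a < 1 -> x \in O -> (a *: x) / p%:R \in O.
Proof.
move=> a1 Ox; rewrite -{1}[a](divfK qp_p_neq0) scale_natr mulfK //.
exact/intcl_scale/Ox/qp_abs_divp.
Qed.

Lemma qp_int_total (a : Q) :
  (a \in (padic_int_pred (Q := Q) : {pred Q})) || (a^-1 \in (padic_int_pred (Q := Q) : {pred Q})).
Proof.
rewrite !unfold_in /padic_int_pred qp_absV; have [//|/ltW a1] := leP (abs a) 1.
by rewrite invf_le1 // (lt_le_trans _ a1).
Qed.

(** A linear dependence divided by its largest coefficient. *)
Lemma qp_dependent (s : seq F) : (\dim {:F} < size s)%N -> exists a : nat -> Q,
  [/\ forall i, abs (a i) <= 1, exists2 i, (i < size s)%N & abs (a i) = 1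
    & \sum_(i < size s) a i *: s`_i = 0].
Proof.
move=> ltn; have : ~~ free (in_tuple s).
  by rewrite /free; apply: contraL ltn => /eqP <-; rewrite -leqNgt dimvS ?subvf.
move/freeP; case/existsNP => k; move/not_implyP => [Hk]; case/existsNP => i0 /eqP ki0.
have [i [ki kle]] := @max_entry _ (GRing.SubringClosed.clone Q (padic_int_pred (Q := Q)) _) qp_int_total _ k i0 ki0.
pose a n := if insub n is Some j then k j / k i else 0.
have aE (j : 'I_(size s)) : a j = k j / k i by rewrite /a valK.
exists a; split.
- by move=> n; rewrite /a; case: insubP => [j _ _|_]; [apply: kle | rewrite qp_abs0].
- by exists i; rewrite // aE divff ?qp_abs1.
under eq_bigr do rewrite aE mulrC -scalerA.
by rewrite -scaler_sumr Hk scaler0.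
Qed.

(** For [s] in [O]: linear independence over Z_p / p of the classes in [O / p O]. *)
Definition free_modp (s : seq F) := forall a : nat -> Q, (forall i, abs (a i) <= 1) ->
  (\sum_(i < size s) a i *: s`_i) / p%:R \in O -> forall i, (i < size s)%N -> abs (a i) < 1.

Lemma free_modp_size s : free_modp s -> (size s <= \dim {:F})%N.
Proof.
move=> fs; rewrite leqNgt; apply/negP => /qp_dependent[a [a1 [i si ai] Sa]].
by have := fs a a1 _ i si; rewrite Sa mul0r rpred0 ai ltxx => /(_ isT).
Qed.

(* A maximal family that is free modulo p generates O modulo p. *)
Lemma intcl_gen_modp : exists s : seq F, {subset s <= O} /\ forall y, exists a : nat -> Q,
  y \in O -> (forall i, abs (a i) <= 1) /\ (y - \sum_(i < size s) a i *: s`_i) / p%:R \in O.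
Proof.
have: exists s : seq F, {subset s <= O} /\ free_modp s by exists [::].
case=> s [sO]; have [k] := ubnP (\dim {:F} - size s)%N.
elim: k s sO => // k IHk s sO; rewrite ltnS => sk fs.
have [gs|/existsNP[y /forallNP Hy]] := pselect (forall y, exists a : nat -> Q,
  y \in O -> (forall i, abs (a i) <= 1) /\ (y - \sum_(i < size s) a i *: s`_i) / p%:R \in O).
  by exists s.
have yO : y \in O by apply: contrapT => yO; apply: (Hy (fun=> 0)) => /yO.
have {}Hy (a : nat -> Q) : (forall i, abs (a i) <= 1) -> ~ (y - \sum_(i < size s) a i *: s`_i) / p%:R \in O.
  by move=> a1 Ha; exact: (Hy a (fun=> conj a1 Ha)).
have fys : free_modp (y :: s).
  move=> a a1; rewrite /= big_ord_recl /= => Ha.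
  (* Were the coefficient of [y] a unit, [y] would be a combination of [s] modulo [p]. *)
  have a0 : abs (a 0%N) < 1.
    rewrite lt_neqAle a1 andbT; apply/eqP => a01.
    have nz : a 0%N != 0 by apply/eqP => a00; move/eqP: a01; rewrite a00 qp_abs0 eq_sym oner_eq0.
    apply: (Hy (fun i => - (a i.+1 / a 0%N))) => [i|].
      by rewrite qp_absN qp_absM qp_absV a01 invr1 mulr1.
    have -> : y - \sum_(i < size s) - (a i.+1 / a 0%N) *: s`_i =
        (a 0%N)^-1 *: (a 0%N *: y + \sum_(i < size s) a (lift ord0 i) *: s`_i).
      rewrite scalerDr scalerA mulVf // scale1r scaler_sumr -sumrN; congr (_ + _).
      by apply: eq_bigr => i _; rewrite scaleNr opprK scalerA mulrC.
    by rewrite -scalerAl intcl_scale // qp_absV a01 invr1.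
  case=> [//|i] /= si; apply: (fs (fun i => a i.+1)) => //.
  have := rpredB Ha (intcl_divp a0 yO).
  by rewrite -mulrBl addrC addKr.
apply: (IHk (y :: s)) => //; first by move=> z; rewrite inE => /orP[/eqP->//|/sO].
by rewrite /= subnS prednK // subn_gt0 (free_modp_size fys).
Qed.

(** Finitely many elements generate [O] modulo [p], so [u n - u 0] is expanded in them digit by
    digit. The coefficients converge in Q_p, and their limits give the limit of [u]. *)
Lemma intcl_p_complete (u : nat -> F) : (forall n, (u n.+1 - u n) / p%:R ^+ n \in O) ->
  exists l, forall n, (u n - l) / p%:R ^+ n \in O.
Proof.
move=> Hu; have [s [sO /choice[c cP]]] := intcl_gen_modp.
pose S (a : nat -> Q) : F := \sum_(i < size s) a i *: s`_i.
pose z n a : F := (u n - u 0%N - S a) / p%:R ^+ n.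
(* [S (a n)] equals [u n - u 0] modulo [p ^ n], the integrality of [z n (a n)]; the next digit is a
   correction by [p ^ n] times coefficients given by [c]. *)
pose fix a n : nat -> Q :=
  if n is m.+1 then fun i => a m i + c (z m.+1 (a m) * p%:R) i * p%:R ^+ m else fun=> 0.
have SD n b b' : S (fun i => b i + b' i * p%:R ^+ n) = S b + S b' * p%:R ^+ n.
  rewrite /S mulr_suml -big_split; apply: eq_bigr => i _ /=.
  by rewrite scalerDl -!natrX scale_natr.
have pn0 n : p%:R ^+ n != 0 :> F by rewrite expf_neq0.
have zO n : z n (a n) \in O -> z n.+1 (a n) * p%:R \in O.
  move=> zn; have -> : z n.+1 (a n) * p%:R = z n (a n) + (u n.+1 - u n) / p%:R ^+ n.
    by rewrite /z exprS; field; rewrite pF_neq0 pn0.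
  by rewrite rpredD.
have aP n : z n (a n) \in O.
  elim: n => [|n IHn].
    by rewrite /z subrr sub0r /S big1 ?oppr0 ?mul0r ?rpred0 // => i _; rewrite scale0r.
  have [_] := cP _ (zO n IHn); rewrite -/(S _).
  suff -> : z n.+1 (a n.+1) = (z n.+1 (a n) * p%:R - S (c (z n.+1 (a n) * p%:R))) / p%:R by [].
  by rewrite {1}/z [a n.+1]/= SD /z exprS; field; rewrite pF_neq0 pn0.
have /choice[l lP] : forall i, exists l, forall n, abs (a n i - l) <= p%:R ^- n.
  move=> i; apply: qp_lim => n /=; rewrite addrC addKr qp_absM qp_absX qp_abs_p exprVn.
  by rewrite ler_piMl ?invr_ge0 ?exprn_ge0 ?(ltW p_gt0) //; have [] := cP _ (zO n (aP n)).
exists (u 0%N + S l) => n.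
have -> : (u n - (u 0%N + S l)) / p%:R ^+ n = z n (a n) + S (fun i => a n i - l i) / p%:R ^+ n.
  have -> : S (fun i => a n i - l i) = S (a n) - S l.
    by rewrite /S -sumrB; apply: eq_bigr => i _ /=; rewrite scalerBl.
  by rewrite /z; field.
rewrite rpredD //; rewrite /S mulr_suml rpred_sum // => i _.
have pQn : p%:R ^+ n != 0 :> Q by rewrite expf_neq0 ?qp_p_neq0.
have -> : (a n i - l i) *: s`_i / p%:R ^+ n = ((a n i - l i) / p%:R ^+ n) *: s`_i.
  by rewrite -{1}[a n i - l i](divfK pQn) -!natrX scale_natr mulfK // natrX.
apply: intcl_scale; last by rewrite sO ?mem_nth.
by rewrite qp_absM qp_absV qp_absX qp_abs_p exprVn invrK -ler_pdivlMr ?exprn_gt0 // mul1r.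
Qed.

(** Scaling a root by [p ^ k] multiplies the coefficient of codegree [m - i] of its minimal
    polynomial by [p ^ (k (m - i))], which clears the denominators for large [k]. *)
Lemma intcl_scale_p (x : F) : exists k, p%:R ^+ k * x \in O.
Proof.
have [q monq rq] : exists2 q : {poly Q}, q \is monic & root (map_poly (in_alg F) q) x.
  have /polyOver1P[q Dq] := minPolyOver 1%AS x.
  exists q; last by rewrite -Dq root_minPoly.
  by have := monic_minPoly 1%AS x; rewrite Dq map_monic.
have [k qk] : exists k, forall i, (i < size q)%N -> abs q`_i <= p%:R ^+ k.
  exists (\sum_(i < size q) Num.bound (abs q`_i))%N => i si.
  apply: le_trans (ltW (archi_boundP (qp_abs_ge0 _))) _.
  rewrite -natrX ler_nat (bigD1 (Ordinal si)) //=.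
  by rewrite (leq_trans _ (ltnW (ltn_expl _ (prime_gt1 p_prime)))) ?leq_addr.
have sq : (0 < size q)%N by rewrite lt0n size_poly_eq0 monic_neq0.
pose m := (size q).-1; pose c i : Q := q`_i * p%:R ^+ (k * (m - i)).
have cm : c m = 1 by rewrite /c subnn muln0 expr0 mulr1 -[LHS]lead_coefE (monicP monq).
pose R := \poly_(i < m.+1) (c i)%:A : {poly F}.
exists k; apply/asboolP/(@integral_root_monic _ _ _ _ R).
- by rewrite monicE lead_coef_poly ?cm ?scale1r ?oner_neq0.
- rewrite /root /R horner_poly.
  suff -> : \sum_(i < m.+1) (c i)%:A * (p%:R ^+ k * x) ^+ i =
      p%:R ^+ (k * m) * (map_poly (in_alg F) q).[x] by rewrite (eqP rq) mulr0.
  rewrite horner_coef size_map_poly -(prednK sq) -/m mulr_sumr; apply: eq_bigr => i _.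
  rewrite coef_map /= /c -natrX scale_natr natrX exprMn -exprM [_%:A * _]mulrC mulrACA.
  by rewrite -exprD -mulnDr subnK // -ltnS.
apply/integral_poly => i; rewrite coef_poly; case: ltnP => im; last exact: integral0.
suff : (c i)%:A \in O by move/asboolP.
rewrite intcl_alg /c qp_absM qp_absX qp_abs_p.
move: im; rewrite ltnS leq_eqVlt => /orP[/eqP ->|im].
  by rewrite subnn muln0 mulr1 -lead_coefE (monicP monq) qp_abs1.
rewrite exprVn ler_pdivrMr ?exprn_gt0 // mul1r.
apply: le_trans (qk i _) _; first by rewrite -(prednK sq) ltnW.
by rewrite ler_eXn2l // leq_pmulr // subn_gt0.
Qed.

Lemma intcl_natV n : ~~ (p %| n)%N -> (n%:R : F)^-1 \in O.
Proof.
move=> pn; have n0 : (0 < n)%N by case: n pn => //; rewrite dvdn0.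
rewrite (_ : _^-1 = (n%:R^-1)%:A); last by rewrite -in_algE fmorphV rmorph_nat.
by rewrite intcl_alg qp_absV qp_abs_nat // lognE p_prime n0 (negPf pn) expr0 !invr1.
Qed.

Lemma fieldext_nat_neq0 n : (0 < n)%N -> n%:R != 0 :> F.
Proof.
move=> n0; rewrite -(rmorph_nat (in_alg F)) fmorph_eq0; apply/eqP => E.
have := qp_abs_nat n0; rewrite E qp_abs0 => /eqP.
by rewrite eq_sym invr_eq0 expf_eq0 gt_eqF ?andbF.
Qed.

(** * From the uniformizer to a complete discrete valuation ring *)

Section Uniformizer.
Variable pi : OF F.
Hypothesis pi_unif : uniformizer pi.
Let w : F := OFval pi.

Let OF_in (b : OF F) : OFval b \in O.
Proof. by case: b. Qed.

Lemma uniformizer_in : w \in O. Proof. exact: OF_in. Qed.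

Let maxid_div x : maxid (in_alg F) x -> exists2 b, b \in O & x = w * b.
Proof.
move=> mx; have Ox : x \in O by have [] := mx.
have [b Db] := (pi_unif (Sub x Ox)).1 mx.
by exists (OFval b) => //; rewrite -[x]/(OFval (Sub x Ox)) Db.
Qed.

Let p_div : exists2 b, b \in O & p%:R = w * b.
Proof. by apply: maxid_div; split; [apply: rpred_nat | right; apply/negP/intcl_pV]. Qed.

Lemma uniformizer_neq0 : w != 0.
Proof.
have [b _] := p_div; apply: contra_eqN => /eqP->; rewrite mul0r.
exact: fieldext_nat_neq0 (prime_gt0 p_prime).
Qed.

Lemma uniformizerV : w^-1 \notin O.
Proof.
have : maxid (in_alg F) w by apply/(pi_unif pi).2; exists 1; rewrite mulr1.
case=> _ [w0|/negP//].
by have /eqP[] := uniformizer_neq0.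
Qed.

Lemma uniformizer_div x : x \in O -> x^-1 \notin O -> x / w \in O.
Proof.
move=> Ox /negP Ox'; have [//|b Ob ->] := maxid_div (x := x); first by split=> //; right.
by rewrite mulrC mulKf ?uniformizer_neq0.
Qed.

(** Enough powers of [w] are dependent over Q_p. Normalize the relation and let [k] be the first
    index with a unit coefficient: the earlier terms are divisible by [p] and the others add up to
    [w ^ k] times a unit. Hence [p] divides [w ^ k]. *)
Lemma uniformizer_exp_divp : exists m, w ^+ m.+1 / p%:R \in O.
Proof.
have w0 := uniformizer_neq0.
pose s := [seq w ^+ i | i <- iota 0 (\dim {:F}).+1].
have [|a [a1 [i si ai] Sa]] := @qp_dependent s; first by rewrite size_map size_iota.
have ss : size s = (\dim {:F}).+1 by rewrite size_map size_iota.
have sE j : (j < size s)%N -> s`_j = w ^+ j.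
  by rewrite ss => sj; rewrite (nth_map 0%N) ?size_iota // nth_iota.
have : exists k, (k < size s)%N && (abs (a k) == 1) by exists i; rewrite si ai eqxx.
move=> /ex_minnP[k /andP[sk /eqP ak] kmin].
have a_lt j : (j < k)%N -> abs (a j) < 1.
  move=> jk; rewrite lt_neqAle a1 andbT; apply/negP => aj.
  by have := kmin j; rewrite aj (ltn_trans jk sk) leqNgt jk => /(_ isT).
exists k.
pose b : F := \sum_(j < size s | (k < j)%N) a j *: w ^+ (j - k.+1).
pose c : F := \sum_(j < size s | (j < k)%N) (a j *: w ^+ j) / p%:R.
have Ob : b \in O by apply: rpred_sum => j _; rewrite intcl_scale // rpredX ?uniformizer_in.
have Oc : c \in O by apply: rpred_sum => j jk; rewrite intcl_divp ?a_lt // rpredX ?uniformizer_in.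
have E : p%:R * c + w ^+ k * ((a k)%:A + w * b) = 0.
  rewrite -[RHS]Sa (bigID (fun j : 'I_(size s) => (j < k)%N)) /=; congr (_ + _).
    rewrite mulr_sumr; apply: eq_bigr => j _.
    by rewrite sE // mulrC divfK.
  rewrite mulrDr (bigD1 (Ordinal sk)) /= ?ltnn //; congr (_ + _).
    by rewrite sE // -scalerAr mulr1.
  rewrite mulrA -exprSr mulr_sumr; apply: eq_big => [j|j kj].
    by rewrite -leqNgt ltn_neqAle andbC eq_sym.
  by rewrite sE // -scalerAr -exprD subnKC.
set v := (a k)%:A + w * b in E.
have Ov : v \in O by rewrite rpredD ?rpredM ?uniformizer_in // intcl_scale ?rpred1.
(* If [w] divided [v], it would divide the unit [a k]. So [v] is itself a unit, by
   [uniformizer_div]. *)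
have nvw : v / w \notin O.
  apply/negP; rewrite mulrDl [w * b]mulrC mulfK // => H.
  have := rpredB H Ob; rewrite addrK -scalerAl mul1r => H'.
  have ak0 : a k != 0 by apply/eqP => a0; move/eqP: ak; rewrite a0 qp_abs0 eq_sym oner_eq0.
  have := intcl_scale (a := (a k)^-1) _ H'; rewrite scalerA mulVf // scale1r qp_absV ak invr1.
  by move=> /(_ (lexx 1)); rewrite (negPf uniformizerV).
have Ov' : v^-1 \in O by apply: contraNT nvw; apply: uniformizer_div.
have v0 : v != 0 by apply: contraNneq nvw => ->; rewrite mul0r rpred0.
have -> : w ^+ k.+1 / p%:R = - (w * c * v^-1).
  have := E; move/eqP; rewrite addr_eq0 => /eqP E'.
  rewrite exprS -(mulfK v0 (w ^+ k)) -[w ^+ k * v]opprK -E'; field.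
  by rewrite pF_neq0 v0.
by rewrite rpredN !rpredM ?uniformizer_in.
Qed.

(** Otherwise some [p ^ k / x] is integral, and its product with [x / p ^ (k + 1)], integral since a
    power of [w] is a multiple of [p], is the inverse of [p]. *)
Lemma uniformizer_sep x : (forall n, x / w ^+ n \in O) -> x = 0.
Proof.
move=> Hx; have w0 := uniformizer_neq0; have [m wm] := uniformizer_exp_divp.
apply/eqP; apply: contraT => x0; have [k Ok] := intcl_scale_p x^-1.
have := rpredM (rpredM Ok (Hx (m.+1 * k.+1)%N)) (rpredX k.+1 wm).
suff -> : p%:R ^+ k * x^-1 * (x / w ^+ (m.+1 * k.+1)) * (w ^+ m.+1 / p%:R) ^+ k.+1 = p%:R^-1.
  by rewrite (negPf intcl_pV).
rewrite exprM; move: (w ^+ m.+1) (expf_neq0 m.+1 w0) => W W0.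
by rewrite expr_div_n !exprS; field; rewrite x0 W0 pF_neq0 !expf_neq0.
Qed.

(* x p^k lies in O, hence is a unit times a power of w; so is p^k. *)
Lemma intcl_total x : (x \in O) || (x^-1 \in O).
Proof.
have w0 := uniformizer_neq0.
have fact y : y != 0 -> y \in O -> exists n, y / w ^+ n \in O /\ (y / w ^+ n)^-1 \in O.
  move=> y0 Oy.
  have : exists n, y / w ^+ n \notin O.
    apply: contrapT => /forallNP H; move/eqP: y0; apply; apply: uniformizer_sep => n.
    by apply: contrapT => /negP/H.
  move=> /ex_minnP[[|n] Hn nmin]; first by rewrite expr0 divr1 Oy in Hn.
  have On : y / w ^+ n \in O by apply: contraT => /nmin; rewrite ltnn.
  exists n; split=> //; apply: contraNT Hn => /(uniformizer_div On).
  by rewrite exprSr invfM mulrA.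
have [->|x0] := eqVneq x 0; first by rewrite rpred0.
have [k Ok] := intcl_scale_p x.
have [|i [i1 i2]] := fact _ _ Ok; first by rewrite mulf_neq0 ?expf_neq0.
have [||j [j1 j2]] := fact (p%:R ^+ k : F); rewrite ?expf_neq0 ?rpredX ?rpred_nat //.
have [ji|ij] := leqP j i; apply/orP; [left | right].
  have -> : x = (p%:R ^+ k * x / w ^+ i) * (p%:R ^+ k / w ^+ j)^-1 * w ^+ (i - j).
    by rewrite -{1}(subnK ji) exprD; field; rewrite !expf_neq0.
  exact: (rpredM (rpredM i1 j2) (rpredX _ uniformizer_in)).
have -> : x^-1 = (p%:R ^+ k / w ^+ j) * (p%:R ^+ k * x / w ^+ i)^-1 * w ^+ (j - i).
  by rewrite -{1}(subnK (ltnW ij)) exprD; field; rewrite x0 !expf_neq0.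
exact: (rpredM (rpredM j1 i2) (rpredX _ uniformizer_in)).
Qed.

(** Since [p] divides [w ^ (m + 1)], the terms of index a multiple of [m + 1] are p-adically Cauchy;
    since [w] divides [p], their p-adic limit is a [w]-adic limit of the whole sequence. *)
Lemma uniformizer_complete (u : nat -> F) : (forall n, (u n.+1 - u n) / w ^+ n \in O) ->
  exists l, forall n, (u n - l) / w ^+ n \in O.
Proof.
move=> Hu; have w0 := uniformizer_neq0; have [m wm] := uniformizer_exp_divp.
have Hle n k : (n <= k)%N -> (u k - u n) / w ^+ n \in O.
  move=> /subnK <-; elim: (k - n)%N => [|i IHi]; first by rewrite subrr mul0r rpred0.
  rewrite addSn -(subrKA (u (i + n)%N)) mulrDl rpredD //.
  have -> : (u (i + n).+1 - u (i + n)%N) / w ^+ n = (u (i + n).+1 - u (i + n)%N) / w ^+ (i + n) * w ^+ i.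
    by rewrite exprD; field; rewrite !expf_neq0.
  exact: (rpredM (Hu _) (rpredX _ uniformizer_in)).
have [|l lP] := @intcl_p_complete (fun n => u (m.+1 * n)%N).
  move=> n; have -> x : x / p%:R ^+ n = x / w ^+ (m.+1 * n) * (w ^+ m.+1 / p%:R) ^+ n :> F.
    by rewrite expr_div_n exprM; field; rewrite !expf_neq0.
  by apply: rpredM; [apply: Hle; rewrite leq_mul2l leqnSn orbT | apply: rpredX].
exists l => n; have [b Ob Dp] := p_div.
rewrite -(subrKA (u (m.+1 * n)%N)) mulrDl rpredD //.
  by rewrite -opprB mulNr rpredN Hle // leq_pmull.
have -> : (u (m.+1 * n)%N - l) / w ^+ n = (u (m.+1 * n)%N - l) / p%:R ^+ n * b ^+ n.
  have b0 : b != 0 by apply: contra_eqN Dp => /eqP->; rewrite mulr0.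
  by rewrite Dp exprMn; field; rewrite !expf_neq0.
exact: (rpredM (lP n) (rpredX _ Ob)).
Qed.
End Uniformizer.
End Extension.
End Padic.

(** * Stable lattices are homothetic *)

Section Homothety.
Variables (p : nat) (Q : padic_field p) (F : fieldExtType Q) (K : splittingFieldType rat).

Local Notation O := (GRing.SubringClosed.clone F (intcl (in_alg F)) _).

Lemma lat_row_span d (rho : mx_representation F 'Gal({:K} / 1)%g d) (T : stable_lattice rho) :
  exists m (B : 'M[F]_(m, d)), row_full B /\ forall v, T v <-> row_span O B v.
Proof.
have [m [B [fB TB]]] := lat_gen T; exists m, B; split=> // v; rewrite TB.
split=> [[a ->]|[a /mxOverP Oa ->]].
  exists (\row_i OFval (a i)); first by apply/mxOverP => i j; rewrite mxE; case: (a j).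
  by rewrite mulmx_sum_row; apply: eq_bigr => i _; rewrite mxE.
exists (fun i => Sub (a 0 i) (Oa 0 i)); rewrite mulmx_sum_row.
by apply: eq_bigr => i _.
Qed.

(** In an adapted basis, [T1] is [T] rescaled by the [f i]. By [adapted_basis_equal] these agree up
    to units, so the single factor [f i0] serves as [c]. *)
Lemma stable_lattices_homothetic d (rho : mx_representation F 'Gal({:K} / 1)%g d)
    (T T1 : stable_lattice rho) (w : OF F) :
  prime p -> galois 1 {:K} -> ~~ (p %| \dim {:K})%N -> uniformizer w -> mx_irreducible rho ->
  exists2 c : F, c != 0 & forall v : 'rV_d, T1 v <-> T (c^-1 *: v).
Proof.
move=> p_prime galK pK wP irr.
have card : #|'Gal({:K} / 1)%g| = \dim {:K} by rewrite -(galois_dim galK) dimv1 divn1.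
have tot := intcl_total p_prime wP.
have [m [B [fB TB]]] := lat_row_span T; have [m1 [B1 [fB1 TB1]]] := lat_row_span T1.
have [P [f [uP f0 PB PB1]]] := lattice_adapted_basis tot fB fB1.
have {TB PB} TP v : T v <-> v *m invmx P \is a mxOver O := iff_trans (TB v) (PB v).
have {TB1 PB1} T1P v : T1 v <-> forall i, (v *m invmx P) 0 i / f i \in O := iff_trans (TB1 v) (PB1 v).
case: d => [|d] in rho T T1 irr B fB B1 fB1 P f uP f0 TP T1P *.
  (* In dimension 0 there is no coordinate to take [c] from. *)
  by exists 1 => [|v]; [apply: oner_neq0 | rewrite (thinmx0 v) scaler0; split=> _; apply: lat0].
have [i0 [_ min0]] := @max_entry _ _ tot _ f 0 (f0 0).
have row_r g i c : c *: row i (P *m rho g *m invmx P) = (c *: row i P) *m rho g *m invmx P.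
  by rewrite !rowE -!scalemxAl !mulmxA.
have rowP i c : (c *: row i P) *m invmx P = c *: delta_mx 0 i.
  by rewrite rowE -scalemxAl mulmxK.
have r_in g i j : g \in 'Gal({:K} / 1)%g -> (P *m rho g *m invmx P) i j \in O.
  move=> gG; have : T (1 *: row i P).
    by apply/TP; rewrite rowP scale1r; apply/mxOverP => k l; rewrite mxE rpred_nat.
  move=> /(lat_stable gG)/TP; rewrite -row_r scale1r => /mxOverP/(_ 0 j).
  by rewrite mxE.
have r_in_f g i j : g \in 'Gal({:K} / 1)%g ->
    f i * (P *m rho g *m invmx P) i j / f j \in O.
  move=> gG; have : T1 (f i *: row i P).
    apply/T1P => k; rewrite rowP !mxE eqxx /=; have [->|_] := eqVneq k i.
      by rewrite mulr1 divff ?rpred1.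
    by rewrite mulr0 mul0r rpred0.
  move=> /(lat_stable gG)/T1P/(_ j); rewrite -row_r.
  by rewrite [X in X / _]mxE [row _ _ _ _]mxE.
have max0 : forall j, f i0 / f j \in O.
  apply: (adapted_basis_equal (uniformizer_in w) (uniformizerV p_prime wP)
    (uniformizer_div p_prime wP) (uniformizer_sep p_prime wP) (uniformizer_complete p_prime wP)
    irr _ _ uP f0 r_in r_in_f min0).
    by rewrite card; apply: intcl_natV.
  by rewrite card; apply: fieldext_nat_neq0 => //; rewrite adim_gt0.
exists (f i0) => // v; rewrite TP T1P -scalemxAl; move: (v *m invmx P) => u.
split=> [Hu|/mxOverP Hu i].
  apply/mxOverP => i j; rewrite !mxE ord1.
  have -> : (f i0)^-1 * u 0 j = u 0 j / f j * (f j / f i0) by field; rewrite !f0.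
  by rewrite rpredM.
have -> : u 0 i / f i = (f i0)^-1 * u 0 i * (f i0 / f i) by field; rewrite !f0.
by have := Hu 0 i; rewrite mxE => H; apply: rpredM (H) (max0 i).
Qed.
End Homothety.

(** * Invariance of the characteristic ideal under isomorphism and duality *)

Section CharIdeal.
Variables (R : comNzRingType) (M N : lmodType R).

(** A cokernel is a type depending on the submodule, so equal images must be equal as records. *)
Lemma submodule_eq (V : lmodType R) (S S' : submodule V) : (forall v, S v <-> S' v) -> S = S'.
Proof.
case: S S' => [S S0 Sl] [S' S0' Sl'] /= SS'; have E : S = S' by apply/funext => v; apply/propext.
by subst S'; rewrite (Prop_irrelevance S0 S0') (Prop_irrelevance Sl Sl').
Qed.

Lemma pseudo_iso_bij n (f : 'I_n -> R) (e : {linear N -> M}) :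
  bijective e -> pseudo_iso M f -> pseudo_iso N f.
Proof.
move=> [e' eK e'K] [phi [kerf cokerf]].
exists (phi \o e : {linear N -> elem_mod f}); split.
  apply: sub_finite_set (finite_image e' kerf) => x /= phix.
  by exists (e x); rewrite ?eK.
suff -> : im_submod (phi \o e : {linear N -> elem_mod f}) = im_submod phi by [].
apply: submodule_eq => v; split=> /= -[x <-]; first by exists (e x).
by exists (e' x); rewrite /= e'K.
Qed.
End CharIdeal.

Lemma char_ideal_bij (R : comNzRingType) (M N : lmodType R) (e : {linear N -> M}) :
  bijective e -> (char_ideal M `<=` char_ideal N)%classic.
Proof.
move=> bij_e a [n [q [k [qP piso qa]]]]; exists n, q, k; split=> //.
exact: pseudo_iso_bij bij_e piso.
Qed.

Section Dual.
Variables (p : nat) (O : comNzRingType) (M N : discrete_module p O) (D : zmodType).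
Variable h : M -> N.
Hypothesis h_lin : forall a x y, h (a *: x + y) = a *: h x + h y.
Hypothesis h_act : forall s x, h (dm_act s x) = dm_act s (h x).

Let hD x y : h (x + y) = h x + h y.
Proof. by have := h_lin 1 x y; rewrite !scale1r. Qed.
Let h0 : h 0 = 0.
Proof. by apply: (@addrI _ (h 0)); rewrite -hD !addr0. Qed.

(** A level that fixes [x] also fixes [h x]; at that level both sides are the same finite sum. *)
Lemma iw_act_morph a x : h (iw_act a x) = iw_act a (h x).
Proof.
have fx := @levelP _ _ M x; set n := level x in fx.
have fhx : fixed_by n (h x) by move=> s Gs; rewrite -h_act fx.
rewrite (iw_actE a fx) (iw_actE a fhx) /iw_act_at.
elim/big_rec2: _ => [//|g y z _ <-].
by rewrite h_lin h_act.
Qed.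

Definition pdual_comp (f : pdual N D) : pdual M D :=
  PDual (fun x y => eq_trans (congr1 f (hD x y)) (pdualD f (h x) (h y))).

Fact pdual_comp_linear : linear pdual_comp.
Proof. by move=> a f g; apply: pdual_eq => x /=; rewrite -iw_act_morph. Qed.
End Dual.

(** Precomposition with [h] is a bijection of the duals, linear over the Iwasawa algebra because [h]
    is equivariant. The reverse inclusion comes from exchanging [h] and [h']. *)
Lemma char_ideal_pdual_sub (p : nat) (O : comNzRingType) (M N : discrete_module p O) (D : zmodType)
    (h : M -> N) (h' : N -> M) :
  (forall a x y, h (a *: x + y) = a *: h x + h y) ->
  (forall a x y, h' (a *: x + y) = a *: h' x + h' y) ->
  (forall s x, h (dm_act s x) = dm_act s (h x)) ->
  cancel h h' -> cancel h' h -> (char_ideal (pdual M D) `<=` char_ideal (pdual N D))%classic.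
Proof.
move=> hl hl' ha hK h'K.
pose e : {linear pdual N D -> pdual M D} :=
  HB.pack (@pdual_comp _ _ _ _ D _ hl)
    (GRing.isLinear.Build _ _ _ _ (@pdual_comp _ _ _ _ D _ hl) (pdual_comp_linear hl ha)).
apply: (char_ideal_bij (e := e)).
by exists (@pdual_comp _ _ _ _ D _ hl') => f; apply: pdual_eq => x /=; rewrite ?hK ?h'K.
Qed.

(** * Selmer groups of homothetic lattices *)

Section SelmerMap.
Local Open Scope classical_set_scope.
Local Notation qrep := generic_quotient.repr.
Variables (p : nat) (Q : padic_field p) (F : fieldExtType Q).
Variables (K : splittingFieldType rat) (iK : {rmorphism K -> algC}).
Variables (d : nat) (rG : mx_representation F 'Gal({:K} / 1)%g d).
Variables (P0 : set algC) (W : 'M[F]_d) (S : seq nat).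

Section OneWay.
Variables (T T1 : stable_lattice rG) (c : F).
Hypothesis TT1 : forall v : 'rV_d, T v -> T1 (c *: v).
Local Notation pi0 := (qpi (lat_submod T)).
Local Notation pi1 := (qpi (lat_submod T1)).

(** Multiplication by [c] from V / T to V / T1; [lat_quot_map_pi] shows that the representative does
    not matter. *)
Definition lat_quot_map (x : lat_quot T) : lat_quot T1 := pi1 (c *: (qrep x : 'rV_d)).
Local Notation phi := lat_quot_map.

Lemma lat_quot_map_pi v : phi (pi0 v) = pi1 (c *: (v : 'rV_d)).
Proof.
apply/qpiP; have /TT1 := (@qpiP _ _ (lat_submod T) (qrep (pi0 v)) v).1 (qpiK _).
by rewrite [_ *: _](@scalerBr F 'rV[F]_d).
Qed.

Lemma lat_quot_map_lin a x y : phi (a *: x + y) = a *: phi x + phi y.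
Proof.
rewrite -[x](@qpiK _ _ (lat_submod T)) -[y](@qpiK _ _ (lat_submod T)).
have E (T' : stable_lattice rG) b u v :
    b *: qpi (lat_submod T') u + qpi (lat_submod T') v = qpi (lat_submod T') (b *: u + v).
  by rewrite raddfD -qpiZ.
rewrite E !lat_quot_map_pi E; congr qpi.
rewrite scalerDr; congr (_ + _).
apply: etrans (@scalerA F 'rV[F]_d c (OFval a) (qrep x)) _; rewrite mulrC.
exact/esym/(@scalerA F 'rV[F]_d).
Qed.

Lemma lat_quot_map_gal s x : phi (galA iK s x) = galA iK s (phi x).
Proof.
rewrite -[x](@qpiK _ _ (lat_submod T)) galA_pi !lat_quot_map_pi galA_pi; congr qpi.
exact: scalemxAl.
Qed.

Lemma lat_quot_mapB x y : phi (x - y) = phi x - phi y.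
Proof. by rewrite addrC -scaleN1r lat_quot_map_lin scaleN1r addrC. Qed.
Lemma lat_quot_map0 : phi 0 = 0.
Proof. by rewrite -(subrr 0) lat_quot_mapB subrr. Qed.

Lemma lat_quot_map_trivial_on (H : set absGalQ) B f :
  trivial_on iK H B f -> trivial_on iK H (phi @` B) (phi \o f).
Proof.
move=> [a Ha]; exists (phi a) => s Hs; exists (f s - (galA iK s a - a)); first exact: Ha.
by rewrite !lat_quot_mapB lat_quot_map_gal.
Qed.

Lemma trivial_onS (H : set absGalQ) (B B' : set (lat_quot T1)) f :
  B `<=` B' -> trivial_on iK H B f -> trivial_on iK H B' f.
Proof. by move=> BB [a Ha]; exists a => s /Ha/BB. Qed.

Let img0 : phi @` [set 0] `<=` [set 0].
Proof. by move=> _ [_ -> <-]; apply: lat_quot_map0. Qed.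

(** The map is equivariant, so it preserves cocycles and local triviality, and it sends A^+ into A^+
    because [W] is a subspace over [F], stable under [c]. *)
Lemma lat_quot_map_selmer n f : selmer iK P0 W S n f -> selmer iK P0 W S n (phi \o f).
Proof.
move=> [f1 [r [rS rf]] fl fp]; split.
- by move=> s t Gs Gt /=; rewrite f1 // -[galA _ _ _]scale1r addrC lat_quot_map_lin scale1r lat_quot_map_gal addrC.
- by exists r; split=> // s t Gs Gt st /=; rewrite (rf s t).
- by move=> l P lS lp Pl; apply: trivial_onS img0 (lat_quot_map_trivial_on (fl l P lS lp Pl)).
move=> t; apply: trivial_onS (lat_quot_map_trivial_on (fp t)).
move=> _ [_ [x [v [vW ->]] <-] <-]; exists (phi (pi0 v)); last by rewrite lat_quot_map_gal.
by exists (c *: (v : 'rV_d)); split; [apply: scalemx_sub | apply: lat_quot_map_pi].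
Qed.

Lemma lat_quot_map_coboundary n f : coboundary iK n f -> coboundary iK n (phi \o f).
Proof. by move=> /lat_quot_map_trivial_on; apply: trivial_onS. Qed.

Local Notation cls0 := (qpi (coboundaries iK T)).
Local Notation cls1 := (qpi (coboundaries iK T1)).

Definition cochain_map (x : cochain_mod iK T) : cochain_mod iK T1 := cls1 (phi \o qrep x).

Lemma cochain_map_cls f : cochain_map (cls0 f) = cls1 (phi \o f).
Proof.
apply/qpiP; have /qpiP[n /lat_quot_map_coboundary fn] := @qpiK _ _ (coboundaries iK T) (cls0 f).
exists n; move: fn; congr coboundary.
by apply/funext => s; apply: lat_quot_mapB.
Qed.

Lemma cochain_map_lin a x y : cochain_map (a *: x + y) = a *: cochain_map x + cochain_map y.
Proof.
rewrite -[x](@qpiK _ _ (coboundaries iK T)) -[y](@qpiK _ _ (coboundaries iK T)).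
have E (T' : stable_lattice rG) b u v :
    b *: qpi (coboundaries iK T') u + qpi (coboundaries iK T') v = qpi (coboundaries iK T') (b *: u + v).
  by rewrite raddfD -qpiZ.
rewrite E !cochain_map_cls E; congr qpi.
by apply/funext => s; apply: lat_quot_map_lin.
Qed.

Lemma cochain_map_act t x : cochain_map (Defs.mact t x) = Defs.mact t (cochain_map x).
Proof.
rewrite -[x](@qpiK _ _ (coboundaries iK T)) mact_cls !cochain_map_cls mact_cls; congr qpi.
by apply/funext => s; apply: lat_quot_map_gal.
Qed.

Fact sel_map_subproof (x : Sel iK T P0 W S) :
  submod_pred (selmer_submod iK T1 P0 W S) (cochain_map (sval x)).
Proof.
case: x => _ /= /asboolP[n [f [fn ->]]]; apply/asboolP; exists n, (phi \o f).
by rewrite cochain_map_cls; split=> //; apply: lat_quot_map_selmer.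
Qed.

Definition sel_map (x : Sel_GV iK T P0 W S) : Sel_GV iK T1 P0 W S :=
  @exist _ (submod_pred (selmer_submod iK T1 P0 W S)) _ (sel_map_subproof x).

Lemma sel_map_lin a x y : sel_map (a *: x + y) = a *: sel_map x + sel_map y.
Proof. by apply: val_inj; apply: cochain_map_lin. Qed.

Lemma sel_map_act t x : sel_map (dm_act t x) = dm_act t (sel_map x).
Proof. by apply: val_inj; apply: cochain_map_act. Qed.
End OneWay.

Lemma sel_mapK (T T1 : stable_lattice rG) (c c' : F)
    (TT1 : forall v : 'rV_d, T v -> T1 (c *: v)) (T1T : forall v : 'rV_d, T1 v -> T (c' *: v)) :
  c' * c = 1 -> cancel (sel_map TT1) (sel_map T1T).
Proof.
move=> c'c x; apply: val_inj; rewrite /= -[sval x](@qpiK _ _ (coboundaries iK T)).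
rewrite !cochain_map_cls //; congr qpi; apply/funext => s /=.
rewrite -[qrep _ s](@qpiK _ _ (lat_submod T)) !lat_quot_map_pi //; congr qpi.
by rewrite scalerA c'c scale1r.
Qed.

Lemma char_ideal_homothetic (T T1 : stable_lattice rG) (c : F) :
  c != 0 -> (forall v : 'rV_d, T1 v <-> T (c^-1 *: v)) ->
  char_ideal (X_GV iK T P0 W S) = char_ideal (X_GV iK T1 P0 W S).
Proof.
move=> c0 TT1.
have T1T (v : 'rV_d) : T1 v -> T (c^-1 *: v) by move/TT1.
have {}TT1 (v : 'rV_d) : T v -> T1 (c *: v) by move=> Tv; apply/TT1; rewrite scalerA mulVf ?scale1r.
have K1 := sel_mapK TT1 T1T (mulVf c0).
have K2 := sel_mapK T1T TT1 (mulfV c0).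
apply/seteqP; split.
  exact: char_ideal_pdual_sub (sel_map_lin TT1) (sel_map_lin T1T) (sel_map_act TT1) K1 K2.
exact: char_ideal_pdual_sub (sel_map_lin T1T) (sel_map_lin TT1) (sel_map_act T1T) K2 K1.
Qed.
End SelmerMap.

Theorem theorem5p1
  (p : nat) (Q : padic_field p)
  (Qbar : closedFieldType) (j : {rmorphism Q -> Qbar}) (ip : {rmorphism algC -> Qbar})
  (K : splittingFieldType rat) (iK : {rmorphism K -> algC})
  (F : fieldExtType Q) (w : OF F)
  (d : nat) (rho : mx_representation F 'Gal({:K} / 1)%g d)
  (W : 'M[F]_d) (S : seq nat) (T T1 : stable_lattice rho) :
  let P := place_prime j ip in
  forall (modW : mxmodule (subg_repr rho (decK_sub iK P)) W),
  prime p -> odd p ->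
  integralRange j ->
  galois 1 {:K} ->
  (exists z : K, p.-primitive_root z) ->
  ~~ (p %| \dim {:K})%N ->
  uniformizer w ->
  mx_irreducible rho ->
  \rank W = dplus iK rho ->
  (0 < dplus iK rho < d)%N ->
  disjoint_constituents (submod_repr modW) (factmod_repr modW) ->
  all prime S -> p \in S ->
  (forall l, prime l -> ramified_in iK l -> l \in S) ->
  rfix_mx rho (decK iK P) = 0 ->
  let X := X_GV iK T P W S in
  let X1 := X_GV iK T1 P W S in
  fin_gen X -> torsion X -> fin_gen X1 -> torsion X1 ->
  char_ideal X = char_ideal X1 /\
  mu_invariant X (iw_const p w) = mu_invariant X1 (iw_const p w).
Proof.
move=> P modW p_prime _ _ galK _ pK wP irr _ _ _ _ _ _ _ X X1 _ _ _ _.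
have [c c0 TT1] := stable_lattices_homothetic T T1 p_prime galK pK wP irr.
have E : char_ideal X = char_ideal X1 by apply: char_ideal_homothetic c0 TT1.
(* The mu-invariant is read off from the characteristic ideal alone. *)
by rewrite /mu_invariant E.
Qed.
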